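(* Let $n$ be a positive even integer and let \[ A_n=\{\Delta_K(t)\;:\;K \text{ is a modular knot and } \deg \Delta_K = n\}\subset \mathbb{Z}[t]. \] Then $\# A_n \le p(n)$, where $p(n)$ is the number of partitions of $n$. In particular, $A_n$ is a finite set.
   Context: Words: let $\{L,R\}^*_{\mathrm{prim}}$ be the set of finite nonempty words over the alphabet $\{L,R\}$ that are primitive (not of the form $U^k$ for a shorter word $U$ and $k\ge 2$). Let $\mathrm{cyc}$ move the first letter of a word to the end. For $W\in\{L,R\}^*_{\mathrm{prim}}$ of length $m\ge 2$, its $m$ cyclic permutations are distinct; for $1\le j\le m$ let $\mathrm{rank}_j(W)\in\{1,\dots,m\}$ be the rank of $\mathrm{cyc}^{j-1}(W)$ among all cyclic permutations of $W$ in ascending lexicographic order with $L<R$, and put $\mathrm{rank}_{m+1}(W)=\mathrm{rank}_1(W)$. The modular braid $\mathbb{M}(W)$ is the $m$-strand braid obtained by placing $m$ points on a top line and $m$ points on a bottom line and joining, for each $1\le j\le m$, the $\mathrm{rank}_j(W)$-th top point to the $\mathrm{rank}_{j+1}(W)$-th bottom point by a straight segment, where at each crossing the strand starting at a top point whose cyclic permutation begins with $L$ passes over the strand starting at a top point whose cyclic permutation begins with $R$ (this is a positive braid). A modular knot is the closure of $\mathbb{M}(W)$ for some $W\in\{L,R\}^*_{\mathrm{prim}}$ of length at least $2$ (such closures are knots). Equivalently, modular knots are the closed orbits of the geodesic flow on $\mathrm{SL}_2(\mathbb{Z})\backslash\mathrm{SL}_2(\mathbb{R})$, i.e. the knots attached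 to classes of indefinite integral binary quadratic forms of positive non-square discriminant. For a knot $K$, $\Delta_K(t)$ denotes its Alexander polynomial, normalized (by multiplication by a unit $\pm t^k$ of $\mathbb{Z}[t,t^{-1}]$) to be a polynomial in $\mathbb{Z}[t]$ with nonzero constant term and $\Delta_K(1)=1$. *)

(* Defs.v *)
From HB Require Import structures.
From mathcomp Require Import all_boot all_order all_algebra.
Set Implicit Arguments. Unset Strict Implicit. Unset Printing Implicit Defensive.
Import Order.TTheory GRing.Theory Num.Theory.

(* Words over {L,R} are encoded as [seq bool] with
   L = false and R = true, so that the letter order L < R is false < true. *)

Fixpoint lexlt (s t : seq bool) : bool :=
  match s, t with
  | x :: s', y :: t' => (~~ x && y) || ((x == y) && lexlt s' t')
  | [::], _ :: _ => true
  | _, _ => false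
  end.

Definition primitive (W : seq bool) : Prop :=
  W <> [::] /\ forall (U : seq bool) (k : nat), 2 <= k -> W <> flatten (nseq k U).

(* cyc^j W = rot j W.  0-based rank of cyc^j W among the cyclic permutations
   of W (i.e. rank_{j+1}(W) - 1 in the paper's 1-based notation). *)
Definition crank (W : seq bool) (j : nat) : nat :=
  count (fun i => lexlt (rot i W) (rot j W)) (iota 0 (size W)).

Definition invrank (W : seq bool) (a : nat) : nat :=
  index a [seq crank W j | j <- iota 0 (size W)].

Definition strand_target (W : seq bool) (a : nat) : nat :=
  crank W ((invrank W a).+1 %% size W).

Definition strand_over (W : seq bool) (a : nat) : bool :=
  ~~ nth false W (invrank W a).

(* One bubble-sort pass over the strand arrangement (strands labelled by their
   top point), starting at position i with carried strand x; it records each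
   adjacent crossing as (position, whether the left strand passes over). *)
Fixpoint bpass (tgt : nat -> nat) (ov : nat -> bool) (i x : nat) (s : seq nat)
  : seq (nat * bool) * seq nat :=
  match s with
  | [::] => ([::], [:: x])
  | y :: s' =>
      if tgt y < tgt x then
        let: (w, r) := bpass tgt ov i.+1 x s' in ((i, ov x) :: w, y :: r)
      else
        let: (w, r) := bpass tgt ov i.+1 y s' in (w, x :: r)
  end.

Fixpoint bsort (tgt : nat -> nat) (ov : nat -> bool) (fuel : nat) (s : seq nat)
  : seq (nat * bool) :=
  match fuel, s with
  | f.+1, x :: s0 =>
      let: (w, s') := bpass tgt ov 0 x s0 in w ++ bsort tgt ov f s'
  | _, _ => [::]
  end.

(* The modular braid M(W) as a braid word: a list of crossings (i, b) meaning
   sigma_i (b = true, left strand over) or sigma_i^{-1} (b = false),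
   positions 0-based, read from top to bottom. *)
Definition modular_braid_word (W : seq bool) : seq (nat * bool) :=
  bsort (strand_target W) (strand_over W) (size W) (iota 0 (size W)).

Local Open Scope ring_scope.

Definition Qt := {fraction {poly int}}.
Definition tt : Qt := tofrac 'X.

Definition burau_gen (m : nat) (c : nat * bool) : 'M[Qt]_m :=
  let: (i, b) := c in
  \matrix_(r, k)
    if (r : nat) == i then
      (if (k : nat) == i then (if b then 1 - tt else 0)
       else if (k : nat) == i.+1 then (if b then tt else 1) else 0)
    else if (r : nat) == i.+1 then
      (if (k : nat) == i then (if b then 1 else tt^-1)
       else if (k : nat) == i.+1 then (if b then 0 else 1 - tt^-1) else 0)
    else ((r : nat) == k)%:R.

Definition burau (m : nat) (w : seq (nat * bool)) : 'M[Qt]_m :=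
  \prod_(c <- w) burau_gen m c.

(* Alexander polynomial of the closure of a braid word w on m strands, up to
   units: the (m-1)-minor of the Alexander (Fox) matrix I - Burau(w) obtained by
   deleting the last row and column. *)
Definition closure_alex_minor (m : nat) (w : seq (nat * bool)) : Qt :=
  let M := 1%:M - burau m w in
  \det (\matrix_(i < m.-1, j < m.-1)
          M (widen_ord (leq_pred m) i) (widen_ord (leq_pred m) j)).

Definition is_alexander_of_modular (W : seq bool) (p : {poly int}) : Prop :=
  p`_0 != 0 /\ p.[1] = 1 /\
  exists (e : bool) (k : int),
    tofrac p = (-1) ^+ e * tt ^ k * closure_alex_minor (size W) (modular_braid_word W).

Local Close Scope ring_scope.

(* Number of partitions of n, counted by multiplicity functions:
   f i = multiplicity of the part i+1 (at most n). *)
Definition partition_number (n : nat) : nat :=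
  #|[set f : {ffun 'I_n -> 'I_n.+1} | \sum_(i < n) (i.+1 * f i) == n]|.

(* Main.v *)
(** A modular braid is a Lorenz braid: its [l] left strands cross over the
    right strands, and it is determined by the word [b = R c L] recording which
    kind of strand ends at each bottom position.  Reading the Burau matrix [B]
    as a random walk down the braid gives all its entries explicitly.
    Since [B] fixes the row vector [(t^i)] on the left and the constant column
    on the right, every bordered determinant of [I - B] is a known multiple of
    one normalised minor [P(c)], which has constant coefficient [1].

    Eliminating one strand shows that leading letters [L] and trailing letters
    [R] of [c] do not change [P(c)].  A word [c] without such letters is the
    boundary path of a Young diagram whose size is the number of inversions of
    [c].  That number is also the degree of [P(c)]: replace one row of [I - B]
    by a unit vector; the matrix of leading row coefficients is then triangular
    for a suitable order.  So the polynomials of degree [n] are indexed by the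
    partitions of [n]. *)
Require Import Defs.
From mathcomp Require Import all_boot all_order all_algebra all_fingroup.
From mathcomp Require Import zify ring.
Set Implicit Arguments. Unset Strict Implicit. Unset Printing Implicit Defensive.
Import Order.TTheory GRing.Theory Num.Theory.
Local Open Scope ring_scope.

(** * Determinants *)

(** The kernel vectors express all blocks of [N] through [M = drsubmx N], so [N + u *m w] factors as
    [diag(1, M)] between two outer matrices, whose determinants are the pairings of [u] with [x] and
    of [w] with the all-ones column. *)
Lemma det_add_rank1 (A : comNzRingType) (k : nat) (N : 'M[A]_(1 + k))
    (x : 'rV[A]_(1 + k)) (u : 'cV[A]_(1 + k)) (w : 'rV[A]_(1 + k)) :
  x 0 0 = 1 -> x *m N = 0 -> N *m (const_mx 1 : 'cV[A]_(1 + k)) = 0 ->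
  \det (N + u *m w) = (x *m u) 0 0 * (w *m (const_mx 1 : 'cV[A]_(1 + k))) 0 0 * \det (drsubmx N).
Proof.
move=> x0 xN N1.
pose x' := rsubmx x; pose M := drsubmx N; pose e : 'cV[A]_k := const_mx 1.
have xE : x = row_mx 1%:M x'.
  rewrite -[LHS]hsubmxK; congr row_mx; apply/rowP=> i.
  by rewrite (ord1 i) !mxE /= -[RHS]x0; congr (x _ _); apply/val_inj.
have eE : (const_mx 1 : 'cV[A]_(1 + k)) = col_mx 1%:M e.
  rewrite -[LHS]vsubmxK; congr col_mx; apply/matrixP=> i j; rewrite !mxE ?ord1 //.
move: xN N1; rewrite -{1 2}[N]submxK xE eE mul_row_block mul_block_col.
rewrite -[RHS](row_mx0) => /eq_row_mx [a1 a2]; rewrite -[RHS](col_mx0) => /eq_col_mx [b1 b2].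
rewrite !mul1mx in a1 a2; rewrite !mulmx1 in b1 b2.
have dlE : dlsubmx N = - (M *m e) by apply/eqP; rewrite -addr_eq0 b2.
have urE : ursubmx N = - (x' *m M) by apply/eqP; rewrite -addr_eq0 a2.
have ulE : ulsubmx N = x' *m M *m e.
  by apply/eqP; rewrite -subr_eq0 -mulNmx -urE b1.
pose u1 := usubmx u; pose u2 := dsubmx u; pose w1 := lsubmx w; pose w2 := rsubmx w.
have -> : N + u *m w = block_mx u1 (- x') u2 1%:M *m block_mx 1%:M 0 0 M *m
                        block_mx w1 w2 (- e) 1%:M.
  rewrite -[N]submxK -[u]vsubmxK -[w]hsubmxK mul_col_row add_block_mx.
  rewrite !mulmx_block !mulmx0 !mulmx1 !add0r !addr0 !mul1mx.
  rewrite dlE urE ulE !mulNmx !mulmxN opprK.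
  by congr block_mx; rewrite addrC.
have -> : block_mx u1 (- x') u2 1%:M =
          block_mx (u1 + x' *m u2) (- x') 0 1%:M *m block_mx 1%:M 0 u2 1%:M.
  rewrite mulmx_block !mulmx0 !mulmx1 !add0r !mul1mx mulNmx addrK.
  by [].
have -> : block_mx w1 w2 (- e) 1%:M =
   block_mx 1%:M w2 0 1%:M *m block_mx (w1 + w2 *m e) 0 (- e) 1%:M.
  rewrite mulmx_block !mulmx0 !mulmx1 !mul0mx !add0r !mul1mx mulmxN addrK.
  by [].
rewrite !det_mulmx det_lblock !det_ublock !det_lblock !det1 !mulr1 !mul1r !det_mx11.
rewrite -mulrA [\det M * _]mulrC mulrA; congr (_ * _ * _).
  by rewrite -[u]vsubmxK mul_row_col mul1mx.
by rewrite -[w]hsubmxK mul_row_col mulmx1.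
Qed.

Definition nat_mx (A : nzRingType) (m : nat) (f : nat -> nat -> A) : 'M[A]_m :=
  \matrix_(i < m, j < m) f i j.

(** Row [0] is [a (e_0 - e_1)]: adding column [0] to column [1] leaves [a] as its only entry. *)
Lemma det_merge_first (A : comNzRingType) (k : nat) (a : A) (f : nat -> nat -> A) :
  f 0 0 = a -> f 0 1 = - a -> (forall j, (1 < j)%N -> f 0%N j = 0) ->
  \det (nat_mx k.+1 f) =
  a * \det (nat_mx k (fun i j => f i.+1 j.+1 + (j == 0%N)%:R * f i.+1 0%N)).
Proof.
move=> f0 f1 f2; rewrite -(add1n k).
pose C : 'cV[A]_k := \col_i f i.+1 0%N.
pose e : 'rV[A]_k := \row_j (j == 0%N :> nat)%:R.
pose M : 'M[A]_k := nat_mx k (fun i j => f i.+1 j.+1 + (j == 0%N)%:R * f i.+1 0%N).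
have E : nat_mx (1 + k) f = block_mx a%:M 0 C M *m block_mx 1%:M (- e) 0 1%:M.
  rewrite mulmx_block !mulmx0 !mulmx1 !addr0.
  apply/matrixP=> i j; rewrite !mxE.
  case: splitP => i' ei; rewrite !mxE; case: splitP => j' ej; rewrite ei ej !mxE ?ord1 ?big_ord1 ?mxE ?eqxx //=.
  - rewrite mulr1n; case: j' ej => [] [|j'] Hj' _ /=; first by rewrite mulrN mulr1.
    by rewrite oppr0 mulr0 f2.
  - rewrite !add1n; case: (j' == 0%N :> nat); ring.
rewrite E det_mulmx det_lblock det_ublock !det1 !mulr1 det_scalar.
by rewrite expr1.
Qed.

Lemma det_merge_last (A : comNzRingType) (k : nat) (a : A) (f : nat -> nat -> A) :
  f k.+1 k.+1 = a -> f k.+1 k = - a -> (forall j, (j < k)%N -> f k.+1 j = 0) ->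
  \det (nat_mx k.+2 f) =
  a * \det (nat_mx k.+1 (fun i j => f i j + (j == k)%:R * f i k.+1)).
Proof.
move=> f0 f1 f2; rewrite -(addn1 k.+1).
pose C : 'cV[A]_k.+1 := \col_i f i k.+1.
pose e : 'rV[A]_k.+1 := \row_j (j == k :> nat)%:R.
pose M : 'M[A]_k.+1 := nat_mx k.+1 (fun i j => f i j + (j == k)%:R * f i k.+1).
have E : nat_mx (k.+1 + 1) f = block_mx M C 0 a%:M *m block_mx 1%:M 0 (- e) 1%:M.
  rewrite mulmx_block !mulmx0 !mulmx1 !add0r.
  apply/matrixP=> i j; rewrite !mxE.
  case: splitP => i' ei; rewrite !mxE; case: splitP => j' ej; rewrite ei ej !mxE ?ord1 ?big_ord1 ?mxE ?eqxx ?addn0 //=.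
  - by rewrite mulrN [_%:R * _]mulrC addrK.
  - have := ltn_ord j'; rewrite ltnS leq_eqVlt => /orP[/eqP->|h].
      by rewrite eqxx !mulr1n mulrN mulr1 f1.
    by rewrite (ltn_eqF h) f2 // oppr0 mulr0.
rewrite E det_mulmx det_lblock det_ublock !det1 !mulr1 det_scalar.
by rewrite expr1 mulrC.
Qed.

(* A permutation other than the identity moves some [i] without increasing [f],
   because the sums of [f] over all indices agree. *)
Lemma det_graded (A : comNzRingType) (m : nat) (M : 'M[A]_m) (f : 'I_m -> nat) :
  (forall i j, i != j -> (f j <= f i)%N -> M i j = 0) -> \det M = \prod_i M i i.
Proof.
move=> H; rewrite /determinant (bigD1 (1%g : 'S_m)) //= [X in _ + X]big1 ?addr0.
  by rewrite odd_perm1 expr0 mul1r; apply: eq_bigr => i _; rewrite perm1.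
move=> s s1; have [i si fi] : exists2 i, s i != i & (f (s i) <= f i)%N.
  apply/exists_inP; apply: contraR s1; rewrite negb_exists_in => /forall_inP Hf.
  have le i : (f i <= f (s i) ?= iff (s i == i))%N.
    apply/leqifP; case: eqP => [->//|/eqP ne]; by rewrite ltnNge Hf.
  have := leqif_sum (P := xpredT) (fun i _ => le i).
  rewrite (reindex_inj (@perm_inj _ s)) /= => -[_].
  rewrite eqxx => /esym/forallP K; apply/eqP/permP => i.
  by rewrite perm1; apply/eqP/(implyP (K i)).
by rewrite (bigD1 i) //= H ?mul0r ?mulr0 // eq_sym.
Qed.

Lemma coef_prod_lead (A : comNzRingType) (I : Type) (s : seq I) (F : I -> {poly A}) (r : I -> nat) :
  (forall i, (size (F i) <= (r i).+1)%N) ->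
  (size (\prod_(i <- s) F i)%R <= (\sum_(i <- s) r i).+1)%N /\
  (\prod_(i <- s) F i)`_(\sum_(i <- s) r i) = \prod_(i <- s) (F i)`_(r i).
Proof.
move=> H; elim: s => [|x s [IH1 IH2]]; first by rewrite !big_nil size_poly1 coef1.
rewrite !big_cons; split.
  apply: leq_trans (size_polyMleq _ _) _.
  by move: (H x) IH1; lia.
rewrite coefM.
have hx : (r x < (r x + \sum_(i <- s) r i).+1)%N by lia.
rewrite (bigD1 (Ordinal hx)) //= addKn IH2 [X in _ + X]big1 ?addr0 // => i.
rewrite -val_eqE /= => ni; case: (ltnP i (r x)) => hi.
  by rewrite [X in _ * X]nth_default ?mulr0 //; apply: leq_trans IH1 _; lia.
rewrite nth_default ?mul0r //; apply: leq_trans (H x) _; lia.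
Qed.

(** Each Leibniz term takes one entry from every row, so row-wise degree bounds add up to the same
    total for all permutations. *)
Lemma coef_det_lead (A : comNzRingType) (m : nat) (M : 'M[{poly A}]_m) (r : 'I_m -> nat) :
  (forall i j, (size (M i j) <= (r i).+1)%N) ->
  (size (\det M) <= (\sum_i r i).+1)%N /\
  (\det M)`_(\sum_i r i) = \det (\matrix_(i, j) (M i j)`_(r i)).
Proof.
move=> H; rewrite /determinant; split.
  apply: leq_trans (size_sum _ _ _) _; apply/bigmax_leqP => s _.
  case: (odd_perm s); rewrite ?expr0 ?expr1 ?mulN1r ?mul1r ?size_polyN;
  by have [] := coef_prod_lead (index_enum _) (fun i => H i (s i)).
rewrite coef_sum; apply: eq_bigr => s _.
case: (odd_perm s); rewrite ?expr1 ?expr0 ?mulN1r ?mul1r ?coefN;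
have [_ ->] := coef_prod_lead (index_enum _) (fun i => H i (s i));
  [congr (- _)|]; apply: eq_bigr => i _; by rewrite mxE.
Qed.

(** * The Burau matrix of a Lorenz braid *)

Definition nR (b : seq bool) (j : nat) : nat := count id (take j b).
Definition nL (b : seq bool) (j : nat) : nat := count negb (take j b).

Lemma nRS b j : (j < size b)%N -> nR b j.+1 = (nR b j + nth false b j)%N.
Proof. by move=> h; rewrite /nR (take_nth false h) -cats1 count_cat /= addn0. Qed.

Lemma nLS b j : (j < size b)%N -> nL b j.+1 = (nL b j + ~~ nth false b j)%N.
Proof. by move=> h; rewrite /nL (take_nth false h) -cats1 count_cat /= addn0. Qed.

Lemma nL_nR b j : (j <= size b)%N -> (nL b j + nR b j = j)%N.
Proof.
elim: j => [|j IH] h; first by rewrite /nL /nR take0.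
by move: (IH (ltnW h)); rewrite nRS // nLS //; case: (nth _ _ _); lia.
Qed.

Lemma nL_le_count b j : (nL b j <= count negb b)%N.
Proof. by rewrite -[X in count _ X](cat_take_drop j) count_cat leq_addr. Qed.

Lemma nR_le_count b j : (nR b j <= count id b)%N.
Proof. by rewrite -[X in count _ X](cat_take_drop j) count_cat leq_addr. Qed.

Lemma count_LR b : (count negb b + count id b = size b)%N.
Proof. by rewrite -(count_predC negb b); congr (_ + _)%N; apply: eq_count => -[]. Qed.

Lemma nL_size b : nL b (size b) = count negb b.
Proof. by rewrite /nL take_size. Qed.

Lemma nR_size b : nR b (size b) = count id b.
Proof. by rewrite /nR take_size. Qed.

Lemma nL_lt_count b j : (j < size b)%N -> ~~ nth false b j -> (nL b j < count negb b)%N.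
Proof. by move=> h nj; have := nL_le_count b j.+1; rewrite nLS // nj addn1. Qed.

Lemma nR_lt_count b j : (j < size b)%N -> nth false b j -> (nR b j < count id b)%N.
Proof. by move=> h nj; have := nR_le_count b j.+1; rewrite nRS // nj addn1. Qed.

Section Lorenz.
Variables (A : comNzRingType) (t : A).

(* [b] lists the strands by bottom position ([true] = R).  The strand ending at
   [j] is R-strand number [nR b j], or L-strand number [nL b j].  Walking down
   L-strand [i], one stays on it with weight [t] at each crossing and drops onto
   the R-strand below with weight [1 - t]; the R-strands to be crossed before
   reaching bottom position [j] are the first [nR b j] ones. *)
Definition lorenz_entry (b : seq bool) (i j : nat) : A :=
  if nth false b j then
    (i == count negb b + nR b j)%N%:R +
    (nL b j <= i < count negb b)%N%:R * (t ^+ nR b j * (1 - t))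
  else (i == nL b j)%:R * t ^+ nR b j.

Lemma sum_delta (m a : nat) (F : nat -> A) : (a < m)%N ->
  \sum_(i < m) F i * (i == a :> nat)%:R = F a.
Proof.
move=> h; rewrite (bigD1 (Ordinal h)) //= eqxx mulr1 big1 ?addr0 // => i.
by rewrite -val_eqE /= => /negPf ->; rewrite mulr0.
Qed.

Lemma sum_geom_window (m p q : nat) : (p <= q)%N ->
  \sum_(i < m) t ^+ i * ((p <= i < q)%N%:R * (1 - t)) = t ^+ minn p m - t ^+ minn q m.
Proof.
move=> pq; elim: m => [|m IH]; first by rewrite big_ord0 !minn0 subrr.
rewrite big_ord_recr /= IH; case: (leqP p m) => pm; case: (ltnP m q) => mq /=.
- by rewrite (minn_idPl (leqW pm)) (minn_idPr mq) mul1r exprS; ring.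
- by rewrite !(minn_idPl _) ?(leqW _) // mul0r mulr0 addr0.
- have mq' := leq_trans pm pq.
  by rewrite (minn_idPr pm) (minn_idPr mq') mul0r mulr0 addr0 !subrr.
- by move: (leq_trans pm (leq_trans pq mq)); rewrite ltnn.
Qed.

(** In an R-column the window telescopes to [t^nR (t^nL - t^l)], with [l] the number of L-strands;
    the [t^l] term cancels against the R-strand itself, and [t^(nL + nR) = t^j] remains. *)
Lemma lorenz_left_kernel b j : (j < size b)%N ->
  \sum_(i < size b) t ^+ i * lorenz_entry b i j = t ^+ j.
Proof.
move=> h; have e := nL_nR (ltnW h); have l := count_LR b.
rewrite /lorenz_entry; case: (boolP (nth false b j)) => bj.
  have r := nR_lt_count h bj.
  under eq_bigr do rewrite mulrDr; rewrite big_split /= (sum_delta (fun i => t ^+ i)); last by lia.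
  under eq_bigr => i _ do rewrite [t ^+ nR b j * _]mulrC mulrA mulrA -[_ * (1 - t)]mulrA.
  rewrite -big_distrl /= sum_geom_window ?nL_le_count //.
  have l1 : (count negb b <= size b)%N by lia.
  rewrite (minn_idPl l1) (minn_idPl (leq_trans (nL_le_count b j) l1)).
  by rewrite mulrBl -!exprD e; ring.
have l' := nL_lt_count h bj.
under eq_bigr do rewrite mulrA; rewrite -big_distrl /= (sum_delta (fun i => t ^+ i)) -?exprD ?e //.
lia.
Qed.

(** In an L-row the drops before the strand's own end telescope to [1 - t^nR], and the end supplies
    the missing [t^nR]; an R-row has just its own [1]. *)
Lemma lorenz_row_prefix b i q : (q <= size b)%N ->
  \sum_(j < q) lorenz_entry b i j =
  if (i < count negb b)%N then (if (nL b q <= i)%N then 1 - t ^+ nR b q else 1)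
  else (i < count negb b + nR b q)%N%:R.
Proof.
elim: q => [_|q IH h].
  by rewrite big_ord0 /nL /nR take0 /= addn0 expr0 subrr; case: ltnP.
rewrite big_ord_recr /= (IH (ltnW h)) /lorenz_entry nRS // nLS //.
case: (boolP (nth false b q)) => bq /=; last first.
  have hl := nL_lt_count h bq; rewrite !addn0 addn1.
  case: (ltngtP i (nL b q)) => hi.
  - by rewrite (ltn_trans hi hl) mul0r addr0.
  - by rewrite mul0r addr0.
  - by rewrite hi hl mul1r subrK.
rewrite addn0; case: (ltnP i (count negb b)) => hi.
  rewrite andbT [i == _]ltn_eqF ?add0r; last lia.
  case: leqP => hj /=; last by rewrite mul0r addr0.
  by rewrite addn1 exprS mul1r; ring.
rewrite andbF mul0r addr0 addnA addn1 ltnS.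
by case: (ltngtP i (count negb b + nR b q)) => // _; rewrite ?addr0 ?add0r.
Qed.

Lemma lorenz_row_sum b i : (i < size b)%N -> \sum_(j < size b) lorenz_entry b i j = 1.
Proof.
move=> h; rewrite lorenz_row_prefix // nL_size nR_size count_LR h.
by case: ltnP => // h'; rewrite leqNgt h'.
Qed.

Definition alex_entry (b : seq bool) (i j : nat) : A := (i == j)%:R - lorenz_entry b i j.

(** Deleting the first row and column, rather than the last, gives constant coefficient [1] for
    words [R c L]. *)
Definition lorenz_alex (b : seq bool) : A :=
  \det (nat_mx (size b).-1 (fun i j => alex_entry b i.+1 j.+1)).

(** The rank-one term can mark a corner or replace a whole row; the resulting determinants are all
    multiples of the same minor. *)
Lemma lorenz_bordered (b : seq bool) (u w : nat -> A) : (0 < size b)%N ->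
  \det (nat_mx (size b) (fun i j => alex_entry b i j + u i * w j)) =
  (\sum_(i < size b) t ^+ i * u i) * (\sum_(j < size b) w j) * lorenz_alex b.
Proof.
case E : (size b) => [//|k] _.
pose N : 'M[A]_(1 + k) := nat_mx k.+1 (alex_entry b).
pose U : 'cV[A]_(1 + k) := \col_i u i; pose V : 'rV[A]_(1 + k) := \row_j w j.
pose x : 'rV[A]_(1 + k) := \row_i t ^+ i.
have x0 : x 0 0 = 1 by rewrite mxE.
have xN : x *m N = 0.
  apply/rowP=> j; rewrite !mxE; under eq_bigr do rewrite !mxE /alex_entry mulrBr.
  rewrite sumrB; have := @lorenz_left_kernel b j; rewrite E => -> //.
  under eq_bigr do rewrite eq_sym; under eq_bigr do rewrite eq_sym.
  by rewrite (sum_delta (fun i => t ^+ i)) ?subrr // E.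
have N1 : N *m (const_mx 1 : 'cV_(1 + k)) = 0.
  apply/matrixP=> i j; rewrite !mxE; under eq_bigr do rewrite !mxE /alex_entry mulr1.
  rewrite sumrB; have := @lorenz_row_sum b i; rewrite E => -> //.
  under eq_bigr do rewrite eq_sym -[_%:R]mul1r.
  by rewrite (sum_delta (fun i => 1)) ?subrr.
have -> : nat_mx k.+1 (fun i j => alex_entry b i j + u i * w j) = N + U *m V.
  by apply/matrixP=> i j; rewrite !mxE big_ord1 !mxE.
rewrite (det_add_rank1 _ _ x0 xN N1) !mxE /lorenz_alex E /=; congr (_ * _); first congr (_ * _).
- by apply: eq_bigr => i _; rewrite !mxE.
- by apply: eq_bigr => i _; rewrite !mxE mulr1.
- by congr (\det _); apply/matrixP=> i j; rewrite !mxE.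
Qed.
End Lorenz.

Lemma lorenz_alex_map (A A' : comNzRingType) (f : {rmorphism A -> A'}) (t : A) b :
  f (lorenz_alex t b) = lorenz_alex (f t) b.
Proof.
rewrite /lorenz_alex -det_map_mx; congr (\det _).
apply/matrixP=> i j; rewrite !mxE /alex_entry /lorenz_entry rmorphB rmorph_nat; congr (_ - _).
case: (nth _ _ _); last by rewrite rmorphM rmorph_nat rmorphXn.
by rewrite rmorphD !rmorphM !rmorph_nat rmorphB rmorph1 rmorphXn.
Qed.

(** * Words [R c L] and the elimination of strands *)

(** No strand of a modular braid ends where it starts, so its first bottom position belongs to an
    R-strand and its last to an L-strand. *)
Definition close_word (c : seq bool) : seq bool := true :: rcons c false.

Lemma size_close_word c : size (close_word c) = (size c).+2.
Proof. by rewrite /= size_rcons. Qed.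

Lemma count_close_word c : count negb (close_word c) = (count negb c).+1.
Proof. by rewrite /= -cats1 count_cat /= addn1 add0n. Qed.

Lemma nR_mono b : {homo nR b : i j / (i <= j)%N}.
Proof.
move=> i j ij; rewrite /nR -[X in (_ <= count id X)%N](cat_take_drop i (take j b)).
by rewrite take_takel // count_cat leq_addr.
Qed.

Lemma nL_mono b : {homo nL b : i j / (i <= j)%N}.
Proof.
move=> i j ij; rewrite /nL -[X in (_ <= count negb X)%N](cat_take_drop i (take j b)).
by rewrite take_takel // count_cat leq_addr.
Qed.

Lemma nR_close_gt0 c j : (0 < j)%N -> (0 < nR (close_word c) j)%N.
Proof. by case: j. Qed.

Lemma nL_close_lt c j : (j < size (close_word c))%N ->
  (nL (close_word c) j < count negb (close_word c))%N.
Proof.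
rewrite size_close_word count_close_word => h.
have -> : nL (close_word c) j = nL (true :: c) j.
  rewrite /nL /close_word -rcons_cons -cats1 takel_cat //.
by rewrite ltnS; apply: (nL_le_count (true :: c)).
Qed.

(* Row [0] of [I - B] is [t (e_0 - e_1)], so the first two columns can be merged;
   this deletes the first L-strand. *)
Lemma lorenz_alex_stripL (A : idomainType) (t : A) c : t != 0 ->
  lorenz_alex t (close_word (false :: c)) = lorenz_alex t (close_word c).
Proof.
move=> t0; set b := close_word (false :: c); set b1 := close_word c.
pose k := (size c).+2.
have sb : size b = k.+1 by rewrite size_close_word.
have sb1 : size b1 = k by rewrite size_close_word.
have ns (m : nat) : \sum_(i < m.+1) (i == m :> nat)%:R = 1 :> A.
  by under eq_bigr do rewrite -[_%:R]mul1r; rewrite (sum_delta (fun => 1)).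
(* The border sits in the last corner, away from the first row; it weighs [t^k] for [b] and
   [t^(k-1)] for [b1]. *)
pose u (m : nat) (i : nat) : A := (i == m)%:R.
have := @lorenz_bordered _ t b (u k) (u k); rewrite sb => /(_ isT).
rewrite (sum_delta (fun i => t ^+ i)) // ns mulr1.
have := @lorenz_bordered _ t b1 (u k.-1) (u k.-1); rewrite sb1 => /(_ isT).
rewrite (sum_delta (fun i => t ^+ i)) // ns mulr1 => E1.
have f2 j : (1 < j)%N -> alex_entry t b 0%N j + u k 0%N * u k j = 0.
  case: j => [|[|j]] // _; rewrite /alex_entry /lorenz_entry /b /close_word /= /u.
  by rewrite /nL /nR /= add0n !mul0r !addr0 if_same subrr.
have f1 : alex_entry t b 0%N 1%N + u k 0%N * u k 1%N = - t.
  by rewrite /alex_entry /lorenz_entry /u /nL /nR /= mul0r addr0 mul1r expr1 sub0r.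
have f0 : alex_entry t b 0%N 0%N + u k 0%N * u k 0%N = t.
  rewrite /alex_entry /lorenz_entry /u /nL /nR /= !mul0r addr0 add0r mul1r expr0 mul1r.
  by rewrite opprB addrC subrK.
rewrite (@det_merge_first _ k _ (fun i j => alex_entry t b i j + u k i * u k j) f0 f1 f2).
set M := nat_mx _ _; rewrite (_ : M = nat_mx k (fun i j => alex_entry t b1 i j + u k.-1 i * u k.-1 j)).
  (* The factor [t] split off by the merging makes both sides multiples of [t^k]. *)
  rewrite E1 mulrA -exprS => /mulfI ->//; exact: expf_neq0.
apply/matrixP=> i j; rewrite !mxE /alex_entry /lorenz_entry /u /b /b1 /close_word /= !add0n.
case: j => [] [|j] hj /=; rewrite ?mul0r ?addr0 ?add0r ?mul1r.
  by rewrite /nR /= !mulr0 !addr0 subr0 !add1n !addSn !eqSS !ltnS !addn0.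
rewrite /nL /nR /= /k !add0n !add1n !addSn !eqSS !ltnS.
by [].
Qed.

(* The last row of [I - B] is [e_{k+1} - e_k], so the last two columns can be merged;
   this deletes the last R-strand. *)
Lemma lorenz_alex_stripR (A : comNzRingType) (t : A) c :
  lorenz_alex t (close_word (rcons c true)) = lorenz_alex t (close_word c).
Proof.
set b := close_word (rcons c true); set b1 := close_word c.
pose k := (size c).+1.
have sb : size b = k.+2 by rewrite size_close_word size_rcons.
have sb1 : size b1 = k.+1 by rewrite size_close_word.
have bE : b = rcons (rcons (true :: c) true) false by [].
have b1E : b1 = rcons (true :: c) false by [].
have cE : count negb b = count negb b1.
  by rewrite /b /b1 !count_close_word -cats1 count_cat /= !addn0.
have takeE j : (j <= k)%N -> take j b = take j b1.
  by move=> h; rewrite bE b1E -!cats1 -catA !takel_cat.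
have nthE j : (j < k)%N -> nth false b j = nth false b1 j.
  by move=> h; rewrite bE b1E -!cats1 -catA !nth_cat h.
have bk : nth false b k by rewrite bE !nth_rcons size_rcons /= ltnSn ltnn eqxx.
have b1k : nth false b1 k = false by rewrite b1E nth_rcons /= ltnn eqxx.
have bk1 : nth false b k.+1 = false.
  by rewrite bE nth_rcons size_rcons /= ltnn eqxx.
have Rk1 : nR b k.+1 = (nR b k).+1 by rewrite nRS ?sb // bk addn1.
have Lk1 : nL b k.+1 = nL b k by rewrite nLS ?sb // bk addn0.
have Lk : count negb b = (nL b k).+1.
  by rewrite -(nL_size b) sb nLS ?sb // bk1 addn1 Lk1.
have Sk : (nL b k + nR b k = k)%N by apply: nL_nR; rewrite sb; lia.
have R0 : (0 < nR b k)%N by apply: nR_close_gt0.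
(* Here the border is the first corner, of weight [t^0 = 1], so nothing has to be cancelled. *)
pose u (i : nat) : A := (i == 0%N)%:R.
have uk : u k = 0 by [].
have uk1 : u k.+1 = 0 by [].
have ns (m : nat) : \sum_(i < m.+1) u i = 1.
  by under eq_bigr do rewrite -[u _]mul1r; rewrite (sum_delta (fun => 1)).
have nt (m : nat) : \sum_(i < m.+1) t ^+ i * u i = 1.
  by rewrite (sum_delta (fun i => t ^+ i)).
have := @lorenz_bordered _ t b u u; rewrite sb ns nt !mul1r => <- //.
have := @lorenz_bordered _ t b1 u u; rewrite sb1 ns nt !mul1r => <- //.
rewrite (@det_merge_last _ _ 1) ?mul1r.
- congr (\det _); apply/matrixP=> i j; rewrite !mxE /alex_entry /lorenz_entry.
  have hi := ltn_ord i; have := ltn_ord j; rewrite ltnS leq_eqVlt => /orP[/eqP-> | hj].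
    rewrite eqxx bk bk1 b1k Lk1 Rk1 /nL /nR -!takeE // -/(nL b k) -/(nR b k).
    rewrite [i == k.+1 :> nat]ltn_eqF // mulr0n sub0r uk uk1 !mulr0 !addr0 mul1r.
    rewrite [i == (_ + _)%N :> nat](_ : _ = false); last by rewrite Lk; lia.
    rewrite mulr0n add0r Lk ltnS -eqn_leq [nL b k == _]eq_sym exprS; ring.
  by rewrite (ltn_eqF hj) mul0r addr0 nthE // /nL /nR cE takeE // ltnW.
- rewrite /alex_entry /lorenz_entry bk1 Lk1 eqxx /u /= mul0r addr0.
  by rewrite [_ == nL b k]gtn_eqF ?mul0r ?subr0 //; lia.
- rewrite /alex_entry /lorenz_entry bk gtn_eqF // /u mul0r addr0 Lk addSn Sk eqxx.
  by rewrite [(k.+1 < _)%N](_ : _ = false) ?andbF ?mul0r ?addr0 ?sub0r //; lia.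
- move=> j hj; have hj1 : (j < k.+1)%N by apply: ltnW.
  rewrite /alex_entry /lorenz_entry (gtn_eqF hj1) /u mul0r addr0 sub0r.
  have e : (nL b j + nR b j = j)%N by apply: nL_nR; rewrite sb; lia.
  case: ifPn => bj; last by rewrite gtn_eqF ?mul0r ?oppr0 //; lia.
  have := nR_mono b (_ : j.+1 <= k)%N; rewrite nRS ?bj ?sb; last by lia.
  move=> /(_ hj) hR; rewrite gtn_eqF; last by lia.
  by rewrite [(_ < count _ _)%N](_ : _ = false) ?andbF ?mul0r ?addr0 ?oppr0 //; lia.
Qed.

(** The leading R makes all exponents of [t] positive in the columns kept, so these powers vanish at
    [t = 0]. The [1] of an R-column lies below the diagonal; the matrix is unitriangular. *)
Lemma lorenz_alex_at0 (A : comNzRingType) c : lorenz_alex (0 : A) (close_word c) = 1.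
Proof.
set b := close_word c; pose k := (size c).+1.
have sb : size b = k.+1 by rewrite size_close_word.
have E i j : (j < k)%N -> (i <= j)%N -> lorenz_entry (0 : A) b i.+1 j.+1 = 0.
  move=> hj ij; rewrite /lorenz_entry.
  have r0 : (0 < nR b j.+1)%N by apply: nR_close_gt0.
  have /prednK <- := r0; rewrite exprS !mul0r !mulr0 addr0.
  have e := @nL_nR b j.+1; have l := @nL_close_lt c j.+1.
  rewrite ltn_eqF ?if_same //; move: e l; rewrite -/b sb; lia.
rewrite /lorenz_alex sb (det_graded (f := fun i => (k - i)%N)).
  rewrite big1 // => i _; rewrite mxE /alex_entry E ?eqxx ?subr0 //.
move=> i j ij; rewrite mxE /alex_entry => h.
have hi : (i < k)%N := ltn_ord i; have hj : (j < k)%N := ltn_ord j.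
have ij' : (i <= j)%N by clearbody k; lia.
by rewrite eqSS (negPf (ij : i != j :> nat)) E ?subrr.
Qed.

Lemma coef0_lorenz_alex c : (lorenz_alex ('X : {poly int}) (close_word c))`_0 = 1.
Proof.
rewrite -horner_coef0 -[LHS]/(horner_eval 0 _) lorenz_alex_map.
by rewrite [X in lorenz_alex X _]hornerX lorenz_alex_at0.
Qed.

(** * Degree of the Alexander polynomial *)

Fixpoint inversions (c : seq bool) : nat :=
  if c is x :: c' then (if x then count negb c' else 0) + inversions c' else 0.

(** Each L contributes the number of R's before it; [a] counts R's in front of [c], as needed for
    the induction and for the leading R of [R c L]. *)
Lemma sum_inversions c a :
  (\sum_(j < size c) (if nth false c j then 0 else nR c j + a) =
   inversions c + a * count negb c)%N.
Proof.
elim: c a => [|x c IH] a; first by rewrite big_ord0 muln0.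
rewrite big_ord_recl /=; case: x => /=.
  rewrite add0n; under eq_bigr do rewrite /nR /= add1n addSnnS.
  by rewrite IH; lia.
rewrite /nR /=; under eq_bigr do rewrite add0n.
by rewrite IH; lia.
Qed.

(* Top position of the strand that ends at bottom position [j]. *)
Definition strand_at (b : seq bool) (j : nat) : nat :=
  if nth false b j then (count negb b + nR b j)%N else nL b j.

Lemma strand_at_lt b j : (j < size b)%N -> (strand_at b j < size b)%N.
Proof.
move=> h; rewrite /strand_at -(count_LR b); case: ifPn => bj.
  by rewrite ltn_add2l nR_lt_count.
by apply: leq_trans (leq_addr _ _); apply: nL_lt_count.
Qed.

Lemma nR_lt b i j : (i < j <= size b)%N -> nth false b i -> (nR b i < nR b j)%N.
Proof. by case/andP=> ij hj bi; have := nR_mono b ij; rewrite nRS ?bi ?addn1 //; lia. Qed.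

Lemma nL_lt b i j : (i < j <= size b)%N -> ~~ nth false b i -> (nL b i < nL b j)%N.
Proof. by case/andP=> ij hj bi; have := nL_mono b ij; rewrite nLS ?bi ?addn1 //; lia. Qed.

Lemma strand_at_inj b i j : (i < size b)%N -> (j < size b)%N ->
  strand_at b i = strand_at b j -> i = j.
Proof.
move=> hi hj; rewrite /strand_at.
have := @nL_lt_count b i hi; have := @nL_lt_count b j hj.
have := @nR_lt b i j; have := @nR_lt b j i; have := @nL_lt b i j; have := @nL_lt b j i.
case: (nth false b i) => /=; case: (nth false b j) => /=; lia.
Qed.

(** With rows indexed by bottom ends, the window condition becomes [j < i]: the walk drops only onto
    strands ending further left. *)
Lemma lorenz_entry_strand (A : comNzRingType) (t : A) b i j :
  (i < size b)%N -> (j < size b)%N ->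
  lorenz_entry t b (strand_at b i) j =
  if nth false b i then (i == j)%:R
  else if nth false b j then (j < i)%:R * (t ^+ nR b j * (1 - t))
  else (i == j)%:R * t ^+ nR b i.
Proof.
move=> hi hj; rewrite /strand_at /lorenz_entry.
have := @nL_lt_count b i hi; have := @nL_lt_count b j hj.
have := @nR_lt b i j; have := @nR_lt b j i; have := @nL_lt b i j; have := @nL_lt b j i.
have := @nL_mono b i j; have := @nL_mono b j i.
case: (boolP (nth false b i)) => /= bi; case: (boolP (nth false b j)) => /= bj H1 H2 H3 H4 H5 H6 H7 H8.
- rewrite [(_ + _ < _)%N](_ : _ = false) ?andbF ?mul0r ?addr0; last by lia.
  rewrite eqn_add2l; case: (ltngtP i j) => ij; last by rewrite ij eqxx.
    by rewrite ltn_eqF // H6 // ij ltnW.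
  by rewrite gtn_eqF // H5 // ij ltnW.
- have h := H7 isT; rewrite [_ == nL b j](_ : _ = false) ?mul0r; last by lia.
  by case: eqP => // e; rewrite -e bi in bj.
- have h := H8 isT; rewrite [nL b i == _](_ : _ = false) ?add0r; last by lia.
  rewrite h andbT; case: (ltngtP i j) => ij; last by rewrite ij bj in bi.
    by rewrite leqNgt H4 // ij ltnW.
  by rewrite H1 // ltnW.
- case: (ltngtP i j) => ij; last by rewrite ij eqxx.
    by rewrite ltn_eqF ?mul0r // H4 // ij ltnW.
  by rewrite gtn_eqF ?mul0r // H3 // ij ltnW.
Qed.

(** A determinant equal to ['X^(l-1)] times the polynomial is computed to top order: its row degrees
    add up to [inversions c + (l - 1)], and its leading matrix is triangular with nonzero
    diagonal. *)
Lemma size_lorenz_alex c :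
  size (lorenz_alex ('X : {poly int}) (close_word c)) = (inversions c).+1.
Proof.
set b := close_word c; pose k := (size c).+1; pose l := count negb b.
have sb : size b = k.+1 by rewrite size_close_word.
have lE : l = (count negb c).+1 by rewrite /l count_close_word.
have bk : nth false b k = false by rewrite /b /close_word -rcons_cons nth_rcons /= ltnn eqxx.
have Lk : nL b k = l.-1.
  by have := nL_size b; rewrite sb nLS ?sb // bk /l => <-; rewrite addn1.
have strk : strand_at b k = l.-1 by rewrite /strand_at bk.
have sum_one (m : nat) (F : nat -> {poly int}) (a : nat) : (a < m)%N ->
    \sum_(i < m) F i * (i == a :> nat)%:R = F a by exact: sum_delta.
(* This border replaces row [l - 1], the strand ending at the last position [k], by [e_k]. Rows of
   [I - B] sum to [0], so [w] sums to [1] and the determinant is ['X^(l-1) * P]. *)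
pose u (i : nat) : {poly int} := (i == l.-1)%:R.
pose w (j : nat) : {poly int} := (j == k)%:R - alex_entry 'X b l.-1 j.
have lk : (l.-1 < k.+1)%N by rewrite -strk -sb strand_at_lt // sb.
have := @lorenz_bordered _ 'X b u w; rewrite sb => /(_ isT).
rewrite (sum_one k.+1 (fun i => 'X^i)) //.
have -> : \sum_(j < k.+1) w j = 1.
  rewrite sumrB; under eq_bigr do rewrite -[_%:R]mul1r.
  rewrite (sum_one _ (fun => 1)) // /alex_entry sumrB.
  under eq_bigr do rewrite eq_sym -[_%:R]mul1r.
  rewrite (sum_one _ (fun => 1)) //.
  by have := @lorenz_row_sum _ ('X : {poly int}) b l.-1; rewrite sb => -> //; rewrite subrr subr0.
rewrite mulr1; set P := lorenz_alex _ _; set F := nat_mx _ _ => detF.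
(* Indexing the rows by the bottom ends of the strands makes every diagonal
   entry attain the maximal degree [r] of its row. *)
pose s0 (j : 'I_k.+1) : 'I_k.+1 := inord (strand_at b j).
have s0E (j : 'I_k.+1) : s0 j = strand_at b j :> nat.
  by rewrite inordK // -[X in (_ < X)%N]sb strand_at_lt // sb.
have s0inj : injective s0.
  move=> i j /(congr1 (@nat_of_ord _)); rewrite !s0E => e; apply/val_inj.
  by apply: strand_at_inj e; rewrite sb.
pose M := row_perm (perm s0inj) F.
(* An L-row has degree [nR b i] on the diagonal; a drop onto an R-strand [j < i] has degree
   [nR b j + 1], which is no larger. All other rows are constant. *)
pose r (i : 'I_k.+1) := if nth false b i || (i == k :> nat) then 0%N else nR b i.
have ME i j : M i j = if i == k :> nat then (j == k :> nat)%:R else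
    (strand_at b i == j)%:R -
   (if nth false b i then (i == j)%:R
    else if nth false b j then (j < i)%:R * ('X ^+ nR b j * (1 - 'X))
    else (i == j)%:R * 'X ^+ nR b i).
  rewrite mxE permE mxE s0E /u /w /alex_entry.
  case: (i =P k :> nat) => [ei|nei].
    by rewrite ei strk eqxx mul1r addrC subrK.
  rewrite (_ : (strand_at b i == l.-1) = false) ?mul0r ?addr0.
    by rewrite lorenz_entry_strand ?sb.
  apply/eqP; rewrite -strk => e; apply: nei.
  by apply: strand_at_inj e; rewrite sb.
have Rlt (i j : 'I_k.+1) : (i < j)%N -> nth false b i -> (nR b i < nR b j)%N.
  by move=> ij; apply: nR_lt; rewrite ij sb ltnW.
have Rpos (i : 'I_k.+1) : ~~ nth false b i -> (0 < nR b i)%N.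
  by case: i => [] [|i] //= hi _; apply: nR_close_gt0.
have Msize i j : (size (M i j) <= (r i).+1)%N.
  rewrite ME /r; case: eqP => [ei|nei]; first by rewrite orbT; case: (_ == _); rewrite ?size_poly1 ?size_poly0.
  rewrite orbF; apply: leq_trans (size_polyD _ _) _.
  rewrite size_polyN geq_max; apply/andP; split.
    by case: (_ == _); rewrite ?size_poly1 ?size_poly0.
  case: ifP => bi; first by case: (_ == _); rewrite ?size_poly1 ?size_poly0.
  case: ifP => bj; last by case: (_ == _); rewrite ?mul1r ?mul0r ?size_polyXn ?size_poly0.
  case: ltnP => ij; rewrite ?mul1r ?mul0r ?size_poly0 //.
  have s1 : (size (1 - 'X : {poly int})%R <= 2)%N.
    by rewrite -opprB size_polyN -[1]/(1%:P) size_XsubC.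
  have h := Rlt _ _ ij bj.
  apply: leq_trans (size_polyMleq _ _) _; rewrite size_polyXn addSn /=.
  by apply: leq_trans (leq_add (leqnn _) s1) _; rewrite addn2.
have [D1 D2] := coef_det_lead Msize.
have D3 : (\det M)`_(\sum_i r i) != 0.
  (* Off the diagonal the leading matrix is nonzero only where [f] increases: from an L-row to the
     last R before it, where [nR b i = nR b j + 1], and from an R-row to column
     [count negb b + nR b i], which has more R's before it or is [k]. *)
  pose f (j : 'I_k.+1) : nat := if j == k :> nat then (2 * size b)%N else
    if nth false b j then (2 * (nR b j).+1)%N else (2 * nR b j).-1.
  rewrite D2 (det_graded (f := f)).
    apply/prodf_neq0 => i _; rewrite mxE ME /r.
    case: (eqVneq (i : nat) k) => [_|ni]; first by rewrite orbT mulr1n coef1.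
    rewrite orbF eqxx ltnn; case: (boolP (nth false b i)) => bi.
      rewrite coefB coefMn coef1 /= /strand_at bi gtn_eqF ?mulr0n ?sub0r //.
      have e := @nL_nR b i; have := @nL_close_lt c i; move: e; rewrite -/b sb.
      have := ltn_ord i; lia.
    have r0 : (0 < nR b i)%N by apply: Rpos.
    rewrite coefB mul1r coefXn eqxx coefMn coef1 (gtn_eqF r0) mul0rn sub0r.
    by [].
  move=> i j ijO; have ij : i != j :> nat := ijO; rewrite mxE ME /r.
  case: (eqVneq (i : nat) k) => [ei _|ni].
    have jk : (j == k :> nat) = false by rewrite -[X in _ == X]ei eq_sym (negPf ij).
    by rewrite jk mulr0n coef0.
  have e := @nL_nR b j; have := @nL_close_lt c j; move: e; rewrite -/b sb.
  move=> /(_ (ltnW (ltn_ord j))) e /(_ (ltn_ord j)) e'.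
  rewrite orbF (negPf ijO); case: (boolP (nth false b i)) => bi.
    rewrite subr0 coefMn coef1 /= => fji.
    rewrite (_ : (strand_at b i == j) = false) // /strand_at bi.
    apply/eqP=> ej; move: fji; rewrite /f (negPf ni) bi.
    have ri : (nR b i < size b)%N.
      by apply: leq_trans (nR_lt_count _ bi) _; rewrite ?sb // -sb -(count_LR b) leq_addl.
    case: eqP => [ek|nk]; first by lia.
    have jk : (j < k <= size b)%N by have := ltn_ord j; rewrite sb; lia.
    case: (boolP (nth false b j)) => bj; first by lia.
    by have := nL_lt jk bj; rewrite Lk /l; lia.
  have r0 : (0 < nR b i)%N by apply: Rpos.
  rewrite coefB coefMn coef1 (gtn_eqF r0) mul0rn sub0r mul0r.
  case: (boolP (nth false b j)) => bj; last by rewrite coef0 oppr0.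
  case: ltnP => ji; rewrite ?mul0r ?coef0 ?oppr0 // mul1r mulrBr mulr1 -exprSr.
  have h := Rlt _ _ ji bj.
  rewrite coefB !coefXn (gtn_eqF h) sub0r opprK => fji.
  rewrite (_ : (nR b i == (nR b j).+1) = false) //; apply/eqP => e1; move: fji.
  by rewrite /f (negPf ni) (negPf bi) bj; case: eqP; [lia|rewrite e1; lia].
have sD : size (\det M) = (\sum_i r i).+1.
  apply/eqP; rewrite eqn_leq D1 ltnNge; apply: contra D3 => h.
  by rewrite nth_default.
have P0 : P != 0 by apply/eqP => h; have := coef0_lorenz_alex c; rewrite -/b -/P h coef0.
move: sD; rewrite /M row_permE det_mulmx det_perm detF.
have -> : size ((-1) ^+ (perm s0inj) * ('X^(l.-1) * P)) = (l.-1 + size P)%N.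
  case: (odd_perm _); rewrite ?expr0 ?expr1 ?mulN1r ?mul1r ?size_polyN;
  by rewrite mulrC size_mulXn.
have -> : (\sum_i r i = inversions c + l.-1)%N; last by lia.
rewrite big_ord_recl big_ord_recr /= /r /= eqxx orbT addn0 add0n lE /=.
(* The offset [1] is the leading R of [R c L], which precedes every L of [c]. *)
rewrite -[X in (_ + X)%N]mul1n -sum_inversions; apply: eq_bigr => i _.
have hi := ltn_ord i.
rewrite /b /close_word /= eqSS (ltn_eqF hi) orbF nth_rcons hi.
by rewrite /nR /= -cats1 takel_cat 1?ltnW // add0n addnC.
Qed.

(** * Stripped words and partitions *)

Definition lorenz_poly (c : seq bool) : {poly int} := lorenz_alex 'X (close_word c).

Lemma lorenz_poly_stripL k c : lorenz_poly (nseq k false ++ c) = lorenz_poly c.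
Proof.
elim: k => //= k IH; rewrite -[RHS]IH.
by apply: lorenz_alex_stripL; rewrite polyX_eq0.
Qed.

Lemma lorenz_poly_stripR k c : lorenz_poly (c ++ nseq k true) = lorenz_poly c.
Proof.
elim: k c => [|k IH] c; first by rewrite cats0.
by rewrite /= -cat_rcons IH; apply: lorenz_alex_stripR.
Qed.

(* [R L^k_0 R L^k_1 ...]: the part [i + 1] has multiplicity [k_i], since [L]'s in
   the [i]-th block are preceded by [i + 1] letters [R]. *)
Definition partition_word (ks : seq nat) : seq bool :=
  flatten [seq true :: nseq k false | k <- ks].

Lemma partition_word_rcons0 ks k :
  partition_word (ks ++ nseq k 0%N) = partition_word ks ++ nseq k true.
Proof.
rewrite /partition_word map_cat flatten_cat; congr cat.
by elim: k => //= k ->.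
Qed.

Lemma partition_word_surj c :
  exists k ks, c = nseq k false ++ partition_word ks.
Proof.
elim: c => [|[] c [k [ks ->]]]; first by exists 0%N, [::].
  by exists 0%N, (k :: ks).
by exists k.+1, ks.
Qed.

Lemma count_partition_word ks : count negb (partition_word ks) = sumn ks.
Proof.
elim: ks => //= k ks IH; rewrite /partition_word /= count_cat count_nseq mul1n.
by rewrite add0n -IH.
Qed.

Lemma inversions_nseq_cat k c : inversions (nseq k false ++ c) = inversions c.
Proof. by elim: k. Qed.

(** A new first block raises every later part by one, as its R precedes all their L's, and adds [k]
    parts equal to [1]. *)
Lemma inversions_partition_word ks :
  inversions (partition_word ks) = (\sum_(i < size ks) i.+1 * nth 0 ks i)%N.
Proof.
elim: ks => [|k ks IH]; first by rewrite big_ord0.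
rewrite /partition_word /= -/(partition_word ks) inversions_nseq_cat IH.
rewrite count_cat count_nseq mul1n count_partition_word big_ord_recl /= mul1n -addnA.
congr (_ + _)%N; rewrite sumnE (big_nth 0%N) big_mkord -big_split /=.
by apply: eq_bigr => i _; rewrite /bump /= add1n [RHS]mulSn.
Qed.

(** * Normalisation up to units *)

(** Both constant coefficients are nonzero, so no power of ['X] is left over; the remaining sign is
    [q.[1]] because [p.[1] = 1]. Thus [q] alone determines [p]. *)
Lemma eq_up_to_unit (p q : {poly int}) (e : bool) (k : int) (a : nat) :
  p`_0 != 0 -> p.[1] = 1 -> q`_0 = 1 ->
  tofrac p = (-1) ^+ e * tt ^ k * tofrac ('X^a * q) ->
  p = q.[1] *: q.
Proof.
move=> p0 p1 q0 E.
have [m [m' Emm]] : exists m m', 'X^m * p = (-1) ^+ e * ('X^m' * q).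
  have sgnE : (-1) ^+ e = tofrac ((-1) ^+ e : {poly int}).
    by rewrite rmorphXn rmorphN1.
  have ttX j : tt ^+ j = tofrac 'X^j by rewrite rmorphXn.
  have tt0 j : tt ^+ j != 0 by rewrite ttX tofrac_eq0 -size_poly_eq0 size_polyXn.
  case: k E => k; rewrite ?NegzE -?exprz_pos_nat => E.
    exists 0%N, (k + a)%N; apply/eqP; rewrite -tofrac_eq; apply/eqP.
    rewrite expr0 mul1r E [RHS]tofracM -sgnE exprD -['X^k * _ * q]mulrA.
    by rewrite [tofrac ('X^k * _)]tofracM -ttX mulrA.
  exists k.+1, a; apply/eqP; rewrite -tofrac_eq; apply/eqP.
  rewrite [LHS]tofracM -ttX E -exprnN -[_ * _^-1 * _]mulrA mulrCA.
  by rewrite mulVKf ?tt0 // [RHS]tofracM -sgnE.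
have Ec j : ('X^m * p)`_j = (-1) ^+ e * ('X^m' * q)`_j.
  by rewrite Emm; case: (e); rewrite ?expr0 ?expr1 ?mul1r ?mulN1r ?coefN.
have mm : m = m'.
  case: (ltngtP m m') => // h.
    have := Ec m; rewrite !coefXnM ltnn subnn h mulr0 => h0.
    by rewrite h0 eqxx in p0.
  have := Ec m'; rewrite !coefXnM ltnn subnn h q0 mulr1; case: (e) => //.
rewrite mm mulrCA in Emm.
have Xm : 'X^m' != 0 :> {poly int} by rewrite -size_poly_eq0 size_polyXn.
have {}Emm := mulfI Xm Emm.
have qe : q.[1] = (-1) ^+ e.
  have := p1; rewrite Emm; case: (e); rewrite ?expr0 ?expr1 ?mul1r ?mulN1r ?hornerN //.
  by move=> /(congr1 -%R); rewrite opprK.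
rewrite qe {1}Emm; case: (e); rewrite ?expr0 ?expr1 ?mul1r ?mulN1r ?scale1r //.
by rewrite scaleN1r.
Qed.

(** * The Burau matrix of a bubble-sorted braid word *)

Definition seqvec (m : nat) (l : seq Qt) : 'cV[Qt]_m := \col_(i < m) nth 0 l i.

(** One crossing of the walk: the over strand comes from the left and either stays on course to the
    right, with weight [tt], or drops onto the strand now at the left. *)
Lemma burau_gen_seqvec m (a c : seq Qt) (u v : Qt) : size (a ++ u :: v :: c) = m ->
  burau_gen m (size a, true) *m seqvec m (a ++ u :: v :: c) =
  seqvec m (a ++ ((1 - tt) * u + tt * v) :: u :: c).
Proof.
rewrite size_cat /= => sm; apply/matrixP=> r z; rewrite !mxE.
pose l := a ++ u :: v :: c.
have nu : nth 0 l (size a) = u by rewrite nth_cat ltnn subnn.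
have nv : nth 0 l (size a).+1 = v by rewrite nth_cat ltnNge leqnSn subSnn.
have sum1 (F : 'I_m -> Qt) i : (i < m)%N ->
   \sum_(j < m) (if (j : nat) == i then F j else 0) * nth 0 l j =
   (if insub i is Some j then F j else 0) * nth 0 l i.
  move=> hi; rewrite (bigD1 (Ordinal hi)) //= eqxx insubT big1 ?addr0 // => j.
  by rewrite -val_eqE /= => /negPf ->; rewrite mul0r.
have sumn (x : Qt) i : (i < m)%N ->
   \sum_(j < m) (if (j : nat) == i then x else 0) * nth 0 l j = x * nth 0 l i.
  by move=> hi; rewrite sum1 // insubT.
have hi1 : ((size a).+1 < m)%N by rewrite -sm; lia.
have hi0 := ltnW hi1.
case: (eqVneq (r : nat) (size a)) => [er|nr].
  rewrite [RHS](_ : _ = (1 - tt) * u + tt * v); last by rewrite er nth_cat ltnn subnn.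
  rewrite -[X in (1 - tt) * X]nu -[X in tt * X]nv -(sumn _ _ hi0) -(sumn _ _ hi1) -big_split /=.
  apply: eq_bigr => k _; rewrite !mxE er eqxx -mulrDl; congr (_ * _).
  case: (eqVneq (k : nat) (size a)) => [->|_]; last by rewrite add0r.
  by rewrite (ltn_eqF (ltnSn _)) addr0.
case: (eqVneq (r : nat) (size a).+1) => [er|nr'].
  rewrite [RHS](_ : _ = 1 * u); last by rewrite er nth_cat ltnNge leqnSn subSnn mul1r.
  rewrite -[X in 1 * X]nu -(sumn _ _ hi0).
  apply: eq_bigr => k _; rewrite !mxE er (gtn_eqF (ltnSn _)) eqxx; congr (_ * _).
  by case: (_ == _) => //; case: (_ == _).
transitivity (nth 0 l r).
  rewrite -[RHS]mul1r -(sumn _ _ (ltn_ord r)); apply: eq_bigr => k _.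
  rewrite !mxE (negPf nr) (negPf nr') eq_sym; congr (_ * _).
  by rewrite -[k == r :> nat]/(nat_of_ord k == r); case: eqP.
rewrite !nth_cat; case: ltnP => // h.
have re : (r = size a + (r - size a) :> nat)%N by rewrite subnKC.
case: (r - size a)%N re => [|[|d]] re //.
  by rewrite re addn0 eqxx in nr.
by rewrite re addn1 eqxx in nr'.
Qed.

Section Bubble.
Variables (tgt : nat -> nat) (ov : nat -> bool).

(* A function [h] on the bottom ends, averaged along the walk that starts on strand
   [x]; [s] lists the strands to the right of [x]. *)
Definition strand_value (h : nat -> Qt) (x : nat) (s : seq nat) : Qt :=
  foldr (fun y v => if (tgt y < tgt x)%N then (1 - tt) * h y + tt * v else v) (h x) s.

Fixpoint strand_values (h : nat -> Qt) (s : seq nat) : seq Qt :=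
  if s is x :: s' then strand_value h x s' :: strand_values h s' else [::].

(** Kept during the sorting, this makes every recorded crossing positive and lets no strand be over
    in one crossing and under in another. *)
Definition over_under (x y : nat) : bool := (tgt y < tgt x)%N ==> (ov x && ~~ ov y).

Lemma size_strand_values h s : size (strand_values h s) = size s.
Proof. by elim: s => //= x s ->. Qed.

Lemma strand_value_id h x s : all (fun y => tgt x <= tgt y)%N s -> strand_value h x s = h x.
Proof. by elim: s => //= y s IH /andP[xy /IH]; rewrite ltnNge xy. Qed.

(** A swap changes just two values. The under strand [y] crosses nothing to its right, so its value
    is [h y]; a strand further left cannot cross the over strand [x], so the order of [x] and [y]
    does not affect it. *)
Lemma strand_values_swap h s x y s' :
  pairwise over_under (s ++ x :: y :: s') -> (tgt y < tgt x)%N ->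
  exists a, [/\ size a = size s,
    strand_values h (s ++ x :: y :: s') =
      a ++ ((1 - tt) * h y + tt * strand_value h x s') :: h y :: strand_values h s' &
    strand_values h (s ++ y :: x :: s') =
      a ++ h y :: strand_value h x s' :: strand_values h s'].
Proof.
move=> + yx; elim: s => [|z s IH] /=.
  rewrite yx; case/and3P => [/andP[xy _] ys _]; exists [::].
  move: xy; rewrite /over_under yx => /andP[ox oy].
  have yid : strand_value h y s' = h y.
    apply: strand_value_id; apply: sub_all ys => w.
    by rewrite /over_under (negPf oy) /= implybF -leqNgt.
  by rewrite /= yid [(tgt x < _)%N]ltnNge ltnW.
case/andP=> zs P; have [a [sa E1 E2]] := IH P; exists (strand_value h z (s ++ x :: y :: s') :: a).
split; rewrite /= ?sa ?E1 ?E2 //; congr (_ :: _).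
move: P zs; rewrite pairwise_cat all_cat /= => /and4P[_ _ /andP[xy _] _] /and4P[_ zx _ _].
rewrite /strand_value !foldr_cat /=; congr foldr.
move: xy zx; rewrite /over_under yx => /andP[ox oy].
by rewrite ox andbF implybF => /negPf ->.
Qed.

Lemma over_under_swap s x y s' :
  pairwise over_under (s ++ x :: y :: s') -> (tgt y < tgt x)%N ->
  pairwise over_under (s ++ y :: x :: s').
Proof.
move=> + yx; rewrite !pairwise_cat !allrel_consr /=.
case/and3P=> /and3P[-> -> ->] -> /= /and3P[/andP[_ ->] -> ->].
by rewrite /over_under [(tgt x < _)%N]ltnNge (ltnW yx).
Qed.

Lemma burau_cons m c w : burau m (c :: w) = burau_gen m c *m burau m w.
Proof. by rewrite /burau big_cons. Qed.

Lemma burau_cat m w w' : burau m (w ++ w') = burau m w *m burau m w'.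
Proof. by rewrite /burau big_cat. Qed.

(** [pre] holds the strands already passed, so its length is the position of the carried strand. *)
Lemma bpass_spec m h s pre x : let: (w, r) := bpass tgt ov (size pre) x s in
  pairwise over_under (pre ++ x :: s) -> size (pre ++ x :: s) = m ->
  [/\ burau m w *m seqvec m (strand_values h (pre ++ r)) = seqvec m (strand_values h (pre ++ x :: s)),
     pairwise over_under (pre ++ r) & perm_eq r (x :: s)].
Proof.
elim: s pre x => [|y s IH] pre x /=; first by rewrite /burau big_nil mul1mx.
have := IH (rcons pre y) x; have := IH (rcons pre x) y; rewrite !size_rcons.
case: ltnP => yx; last first.
  case: bpass => w r + _; rewrite !cat_rcons => H P S; have [H1 H2 H3] := H P S.
  by split=> //; rewrite perm_cons.
case: bpass => w' r' _; case: bpass => w r; rewrite !cat_rcons => H P S.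
have [|H1 H2 H3] := H (over_under_swap P yx); first by move: S; rewrite !size_cat.
have oxy : ov x.
  by move: P; rewrite pairwise_cat /= /over_under yx => /and4P[_ _ /andP[/andP[]]].
have [a [sa E1 E2]] := strand_values_swap h P yx.
split=> //; last first.
  by apply: perm_trans (_ : perm_eq (y :: x :: s) _); rewrite ?perm_cons // (perm_catCA [:: y] [:: x] s).
rewrite burau_cons -mulmxA H1 oxy E1 E2 -sa burau_gen_seqvec //.
by rewrite -E2 size_strand_values -S !size_cat.
Qed.

Fixpoint bsorted (fuel : nat) (s : seq nat) : seq nat :=
  match fuel, s with
  | f.+1, x :: s0 => bsorted f (bpass tgt ov 0 x s0).2
  | _, _ => s
  end.

Lemma bsort_spec m h f s : pairwise over_under s -> size s = m ->
  burau m (bsort tgt ov f s) *m seqvec m (strand_values h (bsorted f s)) =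
    seqvec m (strand_values h s) /\ perm_eq (bsorted f s) s.
Proof.
elim: f s => [|f IH] [|x s] P S /=; try by rewrite /burau big_nil mul1mx perm_refl.
have := @bpass_spec m h s [::] x; case: bpass => w r /(_ P S) [H1 H2 H3] /=.
have [|H4 H5] := IH _ H2; first by rewrite (perm_size H3).
by rewrite burau_cat -mulmxA H4 H1; split=> //; apply: perm_trans H3.
Qed.

Definition tgt_le (x y : nat) := (tgt x <= tgt y)%N.

Lemma bpass_sorted_tail i x s : pairwise tgt_le (x :: s) -> (bpass tgt ov i x s).2 = x :: s.
Proof.
elim: s i x => //= y s IH i x /and3P[/andP[xy xs] ys P].
case: ltnP => [yx|_]; first by move: xy; rewrite /tgt_le leqNgt yx.
have := IH i.+1 y; rewrite /= ys P => /(_ isT).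
by case: bpass => w r /= ->.
Qed.

(* One pass carries the largest target of the unsorted part next to the sorted tail. *)
Lemma bpass_max i x s1 s2 : pairwise tgt_le s2 -> allrel tgt_le (x :: s1) s2 ->
  exists r z, [/\ (bpass tgt ov i x (s1 ++ s2)).2 = r ++ z :: s2, size r = size s1,
    pairwise tgt_le (z :: s2), allrel tgt_le r (z :: s2) & (tgt x <= tgt z)%N].
Proof.
move=> P2; elim: s1 i x => [|y s1 IH] i x A.
  have xs : all (tgt_le x) s2 by move: A; rewrite allrel_consl => /andP[].
  by exists [::], x; rewrite bpass_sorted_tail /= ?P2 ?xs.
move: A; rewrite !allrel_consl => /and3P[xs ys s12] /=; case: ltnP => yx.
  have [|r [z [E sr Pz A xz]]] := IH i.+1 x; first by rewrite allrel_consl xs.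
  exists (y :: r), z; move: E; case: bpass => w r' /= ->; rewrite sr; split=> //.
  rewrite allrel_consl A /= ys !andbT /tgt_le; exact: leq_trans (ltnW yx) xz.
have [|r [z [E sr Pz A yz]]] := IH i.+1 y; first by rewrite allrel_consl ys.
have xz := leq_trans yx yz.
exists (x :: r), z; move: E; case: bpass => w r' /= ->; rewrite sr; split=> //.
by rewrite allrel_consl A /= xs !andbT.
Qed.

Lemma bsorted_pairwise f s1 s2 : (size s1 <= f)%N -> pairwise tgt_le s2 ->
  allrel tgt_le s1 s2 -> pairwise tgt_le (bsorted f (s1 ++ s2)).
Proof.
elim: f s1 s2 => [|f IH] s1 s2; first by case: s1.
case: s1 => [|x s1] hs P2 A /=.
  case: s2 P2 A => //= x s /andP[xs P] _; rewrite bpass_sorted_tail /= ?xs //.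
  by apply: (IH [::]) => //=; rewrite xs.
have [r [z [-> sr Pz Ar _]]] := bpass_max 0 P2 A.
by apply: IH; rewrite ?sr.
Qed.

(** For the indicator of bottom end [j], the values of the sorted arrangement form the unit vector
    [e_j]; the Burau matrix sends it to the values at the top, which are therefore its column
    [j]. *)
Lemma burau_bsort_entry m (i j : 'I_m) :
  pairwise over_under (iota 0 m) -> perm_eq (map tgt (iota 0 m)) (iota 0 m) ->
  burau m (bsort tgt ov m (iota 0 m)) i j =
    strand_value (fun x => (tgt x == j)%:R) i (iota i.+1 (m - i.+1)) /\
  map tgt (bsorted m (iota 0 m)) = iota 0 m /\
  perm_eq (bsorted m (iota 0 m)) (iota 0 m).
Proof.
move=> P Pt; pose h x : Qt := (tgt x == j)%:R.
have [E Ps] := bsort_spec h m P (size_iota 0 m).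
have So : pairwise tgt_le (bsorted m (iota 0 m)).
  by have := @bsorted_pairwise m (iota 0 m) [::]; rewrite cats0 size_iota allrel0r => ->.
set s := bsorted _ _ in E Ps So *.
have tE : map tgt s = iota 0 m.
  apply: (sorted_eq leq_trans anti_leq); last by apply: perm_trans Pt; apply: perm_map.
    by rewrite sorted_pairwise ?pairwise_map //; apply: leq_trans.
  exact: iota_sorted.
split=> //.
have vE : strand_values h s = [seq h x | x <- s].
  elim: s So {E Ps tE} => //= x s IH /andP[xs /IH ->].
  by rewrite strand_value_id.
have dE : seqvec m (strand_values h s) = delta_mx j 0.
  apply/matrixP=> r z; rewrite !mxE ord1 eqxx andbT vE.
  have -> : [seq h x | x <- s] = [seq (y == j :> nat)%:R | y <- map tgt s] by rewrite -map_comp.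
  by rewrite tE (nth_map 0%N) ?size_iota // nth_iota.
rewrite dE in E; have := congr1 (fun v : 'cV_m => v i 0) E.
rewrite -colE !mxE => ->.
have : forall n a k, (k < n)%N -> nth 0 (strand_values h (iota a n)) k =
     strand_value h (a + k)%N (iota (a + k).+1 (n - k.+1)).
  elim=> // n IH a [|k] hk /=; first by rewrite addn0 subn1.
  by rewrite IH // addSnnS.
by move=> ->.
Qed.

End Bubble.

(** * Burau matrices of Lorenz permutations *)

Lemma count_iota_window m a c : (a <= c)%N -> (c <= m)%N ->
  count (fun x => (a <= x < c)%N) (iota 0 m) = (c - a)%N.
Proof.
move=> ac cm.
have -> : iota 0 m = iota 0 a ++ iota a (c - a) ++ iota c (m - c).
  by rewrite -[in iota c _](subnKC ac) -iotaD -[in iota a _](add0n a) -iotaD; congr iota; lia.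
rewrite !count_cat (@eq_in_count _ _ pred0 (iota 0 a)); last first.
  by move=> x; rewrite mem_iota /=; lia.
rewrite (@eq_in_count _ _ predT (iota a _)); last first.
  by move=> x; rewrite mem_iota /=; lia.
rewrite (@eq_in_count _ _ pred0 (iota c _)); last first.
  by move=> x; rewrite mem_iota /=; lia.
by rewrite !count_pred0 count_predT size_iota addn0.
Qed.

(** Strands not ending at [j] have value [0], so each crossing merely multiplies by the staying
    weight [tt]. *)
Lemma strand_fold (tgt : nat -> nat) (T j : nat) (s : seq nat) (v : Qt) :
  all (fun y => tgt y != j) s ->
  foldr (fun y v => if (tgt y < T)%N then (1 - tt) * (tgt y == j)%:R + tt * v else v) v s =
  tt ^+ count (fun y => (tgt y < T)%N) s * v.
Proof.
elim: s => [|y s IH] /=; first by rewrite expr0 mul1r.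
case/andP=> /negPf -> /IH ->; case: ltnP => _; last by [].
by rewrite mulr0 add0r add1n exprS mulrA.
Qed.

Section LorenzPermutation.
Variables (m l : nat) (tgt : nat -> nat) (ov : nat -> bool).
Hypothesis lm : (0 < l < m)%N.
Hypothesis monoL : forall x y, (x < y < l)%N -> (tgt x < tgt y)%N.
Hypothesis monoR : forall x y, (l <= x)%N -> (x < y < m)%N -> (tgt x < tgt y)%N.
Hypothesis tgtP : perm_eq (map tgt (iota 0 m)) (iota 0 m).
Hypothesis ovE : forall x, (x < m)%N -> ov x = (x < l)%N.

Lemma lorenz_over_under : pairwise (over_under tgt ov) (iota 0 m).
Proof.
apply/(pairwiseP 0%N) => x y; rewrite !inE !size_iota => hx hy xy.
rewrite !nth_iota // !add0n /over_under !ovE //; apply/implyP => h.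
case: (ltnP x l) => xl; last by have := monoR xl (_ : x < y < m)%N; rewrite xy hy; lia.
by case: (ltnP y l) => yl //=; have := @monoL x y; rewrite xy yl; lia.
Qed.

Lemma lorenz_tgt_inj x y : (x < m)%N -> (y < m)%N -> tgt x = tgt y -> x = y.
Proof.
move=> hx hy e; have : uniq (map tgt (iota 0 m)) by rewrite (perm_uniq tgtP) iota_uniq.
move=> /(uniqP 0%N) /(_ x y); rewrite !inE size_map size_iota => /(_ hx hy).
by rewrite !(nth_map 0%N) ?size_iota // !nth_iota // !add0n; apply.
Qed.

Let s := bsorted tgt ov m (iota 0 m).
Let b := [seq (l <= x)%N | x <- s].

(** The walk from strand [i] is evaluated by splitting the strands to its right at the strand [y]
    ending at [j]: drops elsewhere contribute nothing, and crossings before [y] give powers of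
    [tt]. *)
Lemma lorenz_burau : [/\ size b = m, count negb b = l,
   (forall j, (j < m)%N -> exists2 x, (x < m)%N & tgt x = j /\ nth false b j = (l <= x)%N) &
   forall i j : 'I_m, burau m (bsort tgt ov m (iota 0 m)) i j = lorenz_entry tt b i j].
Proof.
case/andP: (lm) => l0 lm'.
have i0 : 'I_m by exists 0%N; apply: leq_trans lm'.
have [_ [tE ps]] := burau_bsort_entry i0 i0 lorenz_over_under tgtP; rewrite -/s in tE ps.
have ss : size s = m by rewrite (perm_size ps) size_iota.
have sb : size b = m by rewrite size_map.
have st j : (j < m)%N -> tgt (nth 0%N s j) = j.
  by move=> hj; rewrite -(nth_map _ 0%N) ?ss // tE nth_iota.
have sm j : (j < m)%N -> (nth 0%N s j < m)%N.
  rewrite -{1}ss => hj; have := mem_nth 0%N hj.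
  by rewrite (perm_mem ps) mem_iota.
have nb j : (j < m)%N -> nth false b j = (l <= nth 0%N s j)%N.
  by move=> hj; rewrite (nth_map 0%N) ?ss.
have cb : count negb b = l.
  rewrite count_map (seq.permP ps) -[RHS]subn0 -(@count_iota_window m 0 l) //; last exact: ltnW.
  by apply: eq_count => x /=; rewrite -ltnNge.
have takeE (P : pred nat) j : (j <= m)%N ->
    count P (take j s) = count (fun x => P x && (tgt x < j)%N) (iota 0 m).
  move=> hj; rewrite -(seq.permP ps).
  have E : [seq tgt x | x <- take j s] = iota 0 j.
    by rewrite map_take tE take_iota (minn_idPl hj).
  have E' : [seq tgt x | x <- drop j s] = iota j (m - j).
    by rewrite map_drop tE drop_iota.
  rewrite -[in RHS](cat_take_drop j s) count_cat -[LHS]addn0; congr (_ + _)%N.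
    apply: eq_in_count => x /(map_f tgt); rewrite E mem_iota add0n => /andP[_ ->].
    by rewrite andbT.
  apply/esym/eqP; rewrite -leqn0 leqNgt -has_count; apply/hasPn => x /(map_f tgt).
  by rewrite E' mem_iota => /andP[h _]; rewrite negb_and -leqNgt h orbT.
have nLE j : (j <= m)%N -> nL b j = count (fun x => (x < l)%N && (tgt x < j)%N) (iota 0 m).
  move=> hj; rewrite /nL -map_take count_map -takeE //.
  by apply: eq_count => x /=; rewrite -ltnNge.
have nRE j : (j <= m)%N -> nR b j = count (fun x => (l <= x)%N && (tgt x < j)%N) (iota 0 m).
  by move=> hj; rewrite /nR -map_take count_map -takeE.
split=> //.
  by move=> j hj; exists (nth 0%N s j); rewrite ?sm // st // nb.
move=> i j; have hi := ltn_ord i; have hj := ltn_ord j; have hj' := ltnW hj.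
have [-> _] := burau_bsort_entry i j lorenz_over_under tgtP.
rewrite /lorenz_entry nb // cb; set y := nth 0%N s j.
have ty : tgt y = j by exact: st.
have ym : (y < m)%N by exact: sm.
have tneq x : (x < m)%N -> x != y -> tgt x != j.
  by move=> hx xy; apply: contraNneq xy => e; apply/eqP/lorenz_tgt_inj; rewrite ?ty.
have nLy : (y < l)%N -> nL b j = y.
  move=> yl; rewrite nLE // -[RHS]subn0 -(@count_iota_window m 0 y) ?(ltnW ym) //.
  apply: eq_in_count => x; rewrite mem_iota /= add0n => hx; rewrite -ty.
  case: (ltngtP x y) => xy; last by rewrite xy ltnn andbF.
    by rewrite (ltn_trans xy yl) monoL // xy yl.
  by case: (ltnP x l) => // xl; have := monoL (_ : y < x < l)%N; rewrite xy xl; lia.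
have nRy : (l <= y)%N -> nR b j = (y - l)%N.
  move=> yl; rewrite nRE // -(@count_iota_window m l y) ?(ltnW ym) //.
  apply: eq_in_count => x; rewrite mem_iota /= add0n => hx; rewrite -ty.
  case: (leqP l x) => //= lx.
  case: (ltngtP x y) => xy; last by rewrite xy ltnn.
    by rewrite monoR // xy ym.
  by have := monoR yl (_ : y < x < m)%N; rewrite xy hx; lia.
have value0 x : (x < m)%N -> (tgt x == j)%:R = (x == y)%:R :> Qt.
  move=> hx; case: (eqVneq x y) => [->|ne]; first by rewrite ty eqxx.
  by rewrite (negPf (tneq _ hx ne)).
case: (ltnP i l) => il; last first.
  rewrite strand_value_id; last first.
    apply/allP => x; rewrite mem_iota => hx; apply: ltnW; apply: monoR => //; lia.
  rewrite value0 // andbF mul0r addr0; case: (leqP l y) => ly.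
    by rewrite nRy // subnKC.
  by rewrite nLy // !(gtn_eqF (leq_trans ly il)) mul0r.
rewrite andbT /strand_value.
have notin p q : (p + q <= m)%N -> (y < p)%N || (p + q <= y)%N -> all (fun x => tgt x != j) (iota p q).
  move=> pq yp; apply/allP => x; rewrite mem_iota => hx; apply: tneq; first lia.
  by apply/eqP => e; move: hx yp; rewrite e; lia.
have split_at : (i < y)%N ->
    iota i.+1 (m - i.+1) = iota i.+1 (y - i.+1) ++ y :: iota y.+1 (m - y.+1).
  move=> iy; have -> : y :: iota y.+1 (m - y.+1) = iota (i.+1 + (y - i.+1)) (m - y).
    by rewrite subnKC // -[(m - y)%N]prednK ?subn_gt0 //= -subnS.
  by rewrite -iotaD; congr iota; lia.
case: (leqP l y) => ly.
  have iy := leq_trans il ly.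
  rewrite split_at // foldr_cat /= !strand_fold ?notin ?subnKC ?leqnn ?ltnSn ?orbT //; try lia.
  rewrite ty eqxx value0 // (ltn_eqF iy) mulr0 mulr0 addr0 mulr1.
  rewrite [i == _ :> nat]ltn_eqF ?add0r; last by apply: leq_trans il (leq_addr _ _).
  (* [nL b j] counts the L-strands ending left of [j], which by monotonicity are the first ones. *)
  have -> : (nL b j <= i)%N = (j < tgt i)%N.
    rewrite nLE //; case: (ltngtP (tgt i) j) => ij.
    - apply/negbTE; rewrite -ltnNge -[X in (X <= _)%N]subn0 -(@count_iota_window m 0 i.+1) //.
      apply: sub_count => x /= xi; rewrite (leq_trans xi il) /=.
      move: xi; rewrite ltnS leq_eqVlt => /orP[/eqP->//|xi].
      by apply: ltn_trans ij; apply: monoL; rewrite xi il.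
    - rewrite -[X in (_ <= X)%N]subn0 -(@count_iota_window m 0 i) //; last exact: ltnW.
      apply: sub_count => x /= /andP[xl xj]; rewrite ltnNge; apply/negP => ix.
      move: xj; rewrite ltnNge => /negP; apply; apply: leq_trans (ltnW ij) _.
      move: ix; rewrite leq_eqVlt => /orP[/eqP->//|ix].
      by apply/ltnW/monoL; rewrite ix xl.
    - by have := tneq i hi (_ : i != y :> nat); rewrite ij eqxx (ltn_eqF iy) => /(_ isT).
  case: ltnP => ij; last by rewrite mul0r mulr0.
  rewrite mul1r; congr (_ ^+ _ * _).
  (* The strands crossed before [y] are exactly the R-strands from [l] to [y - 1]. *)
  rewrite nRy // -(@count_iota_window m l y) ?(ltnW ym) //.
  have -> : iota 0 m = iota 0 i.+1 ++ iota i.+1 (y - i.+1) ++ iota y (m - y).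
    rewrite -[in iota y _](subnKC iy) -iotaD -[in iota i.+1 _](add0n i.+1) -iotaD.
    by congr iota; lia.
  rewrite !count_cat [X in (_ + (_ + X))%N](@eq_in_count _ _ pred0); last first.
    by move=> x; rewrite mem_iota /=; lia.
  rewrite [X in (X + _)%N](@eq_in_count _ _ pred0); last first.
    by move=> x; rewrite mem_iota /=; lia.
  rewrite !count_pred0 add0n addn0; apply: eq_in_count => x; rewrite mem_iota subnKC // => /andP[ix xy].
  rewrite xy andbT; case: (leqP l x) => lx.
    by apply: ltn_trans ij; rewrite -ty; apply: monoR; rewrite // xy.
  by apply/negbTE; rewrite -leqNgt ltnW // monoL // ix.
(* The walk never drops onto an L-strand [y], so only [i = y] contributes, with one factor [tt] per
   R-strand ending left of [j]. *)
rewrite nLy //; case: (ltngtP i y) => iy.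
- rewrite split_at // foldr_cat /= !strand_fold ?notin ?subnKC ?leqnn ?ltnSn ?orbT //; try lia.
  rewrite ty eqxx value0 // (ltn_eqF iy) mulr0 ifF ?mulr0 ?mul0r //.
  by apply/negbTE; rewrite -leqNgt -ty ltnW // monoL // iy.
- rewrite strand_fold; last by apply: notin; lia.
  by rewrite value0 // (gtn_eqF iy) mulr0 mul0r.
- rewrite strand_fold; last by apply: notin; lia.
  rewrite value0 // -iy eqxx mulr1 mul1r; congr (_ ^+ _).
  rewrite nRE // -[j : nat]ty -iy.
  have -> : iota 0 m = iota 0 i.+1 ++ iota i.+1 (m - i.+1).
    by rewrite -[in iota i.+1 _](add0n i.+1) -iotaD; congr iota; lia.
  rewrite count_cat [X in (X + _)%N](@eq_in_count _ _ pred0); last first.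
    by move=> x; rewrite mem_iota /=; lia.
  rewrite count_pred0 add0n; apply: eq_in_count => x; rewrite mem_iota => hx.
  case: (leqP l x) => lx //=.
  by apply/negbTE; rewrite -leqNgt ltnW // monoL //; lia.
Qed.

End LorenzPermutation.

(** * Ranks of cyclic permutations *)

Local Open Scope nat_scope.

(** As in Euclid's algorithm, the shorter word is a prefix of the longer one, and the remainder
    again commutes with it. *)
Lemma commuting_words (T : eqType) (u v : seq T) : u ++ v = v ++ u ->
  exists z i j, u = flatten (nseq i z) /\ v = flatten (nseq j z).
Proof.
have [n] := ubnP (size u + size v); elim: n u v => // n IH u v hn uv.
wlog uv_le : u v hn uv / size u <= size v.
  move=> H; case: (leqP (size u) (size v)) => [|/ltnW] h; first exact: H.
  have [|||z [i [j [-> ->]]]] := H v u; rewrite 1?addnC //.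
  by exists z, j, i.
case: u hn uv uv_le => [|x u] hn uv uv_le.
  by exists v, 0, 1; rewrite /= cats0.
have vE : v = (x :: u) ++ drop (size (x :: u)) v.
  rewrite -{1}[v](cat_take_drop (size (x :: u))); congr cat.
  by rewrite -(takel_cat (x :: u) uv_le) -uv take_size_cat.
move: (drop _ v) vE => v' vE; rewrite {}vE in hn uv *.
have [||z [i [j [ui vj]]]] := IH (x :: u) v'.
- by move: hn; rewrite size_cat /=; lia.
- by move: uv; rewrite -catA => /eqP; rewrite eqseq_cat // eqxx => /eqP.
exists z, i, (i + j); split=> //.
by rewrite nseqD flatten_cat -ui -vj.
Qed.

(** A rotation fixing [W] makes its two pieces commute; they are then powers of one word, and so is
    [W], with exponent at least [2]. *)
Lemma primitive_rot (W : seq bool) k : primitive W -> 0 < k < size W -> rot k W <> W.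
Proof.
move=> [_ P] /andP[k0 kW] E.
have comm : take k W ++ drop k W = drop k W ++ take k W by rewrite cat_take_drop -[LHS]E.
have [z [i [j [ui vj]]]] := commuting_words comm.
suff ij : 2 <= i + j.
  by have := P z _ ij; rewrite nseqD flatten_cat -ui -vj cat_take_drop.
have : 0 < i by case: i ui => // /(congr1 size); rewrite size_takel ?(ltnW kW) //=; lia.
have : 0 < j by case: j vj => // /(congr1 size); rewrite size_drop /=; lia.
lia.
Qed.

Lemma lexlt_irr s : lexlt s s = false.
Proof. by elim: s => //= x s ->; case: x. Qed.

Lemma lexlt_trans : transitive lexlt.
Proof.
by elim=> [|y t IH] [|x s] [|z u] //=; case: x y z => [] [] [] //=; apply: IH.
Qed.

Lemma lexlt_total s t : size s = size t -> [|| lexlt s t, s == t | lexlt t s].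
Proof.
elim: s t => [|x s IH] [|y t] //= [/IH]; rewrite eqseq_cons.
by case: x y => [] [] //=; rewrite ?orbT.
Qed.

Lemma lexlt_cat s t u v : size s = size t -> lexlt s t -> lexlt (s ++ u) (t ++ v).
Proof.
elim: s t => [|x s IH] [|y t] //= [/IH H]; case: x y => [] [] //=; exact: H.
Qed.

Lemma sub_in_count (T : eqType) (a1 a2 : pred T) (s : seq T) :
  {in s, forall x, a1 x -> a2 x} -> count a1 s <= count a2 s.
Proof.
move=> a12; rewrite -(@eq_in_count _ (predI a1 a2)); first by apply: sub_count => x /andP[].
by move=> x /a12 h /=; case: (a1 x) h => // ->.
Qed.

Section Rank.
Variable W : seq bool.
Hypotheses (W_prim : primitive W) (W_size : 2 <= size W).
Let m := size W.
Let l := count negb W.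

Lemma rot_inj_primitive i j : i < m -> j < m -> rot i W = rot j W -> i = j.
Proof.
wlog ij : i j / i <= j.
  move=> H hi hj e; case: (leqP i j) => [|/ltnW] h; first exact: H.
  by apply/esym/H.
move=> hi hj e; apply/eqP; rewrite eqn_leq ij leqNgt; apply/negP => lt.
apply: (primitive_rot W_prim (_ : 0 < j - i < size W)); first by rewrite -/m; lia.
apply: (@rot_inj i); rewrite -rotD subnKC // ?e //; exact: ltnW.
Qed.

Lemma crank_mono i j : i < m -> j < m -> lexlt (rot i W) (rot j W) -> crank W i < crank W j.
Proof.
move=> hi hj ij; rewrite /crank -/m.
have -> : iota 0 m = iota 0 i ++ i :: iota i.+1 (m - i.+1).
  have -> : i :: iota i.+1 (m - i.+1) = iota i (m - i) by rewrite -[m - i]prednK ?subn_gt0 //= -subnS.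
  by rewrite -[in iota i _](add0n i) -iotaD subnKC // ltnW.
rewrite !count_cat /= lexlt_irr ij add0n add1n addnS ltnS.
by apply: leq_add; apply: sub_count => k /= h; apply: lexlt_trans h ij.
Qed.

Lemma crank_lt i j : i < m -> j < m -> (crank W i < crank W j) = lexlt (rot i W) (rot j W).
Proof.
move=> hi hj; apply/idP/idP; last exact: crank_mono.
move=> h; have := @lexlt_total (rot i W) (rot j W); rewrite !size_rot => /(_ erefl).
case/or3P => // [/eqP e|/(crank_mono hj hi)]; last by lia.
by move: h; rewrite (rot_inj_primitive hi hj e) ltnn.
Qed.

Lemma crank_inj i j : i < m -> j < m -> crank W i = crank W j -> i = j.
Proof.
move=> hi hj e; apply: rot_inj_primitive => //.
have := @lexlt_total (rot i W) (rot j W); rewrite !size_rot => /(_ erefl).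
by rewrite -!crank_lt // e ltnn /= orbF => /eqP.
Qed.

Lemma crank_lt_size i : i < m -> crank W i < m.
Proof.
move=> hi; rewrite /crank -/m -[X in _ < X](size_iota 0 m).
rewrite -(count_predC (fun k => lexlt (rot k W) (rot i W))) -addn1 leq_add2l -has_count.
apply/hasP; exists i.
  by rewrite mem_iota.
by rewrite /= lexlt_irr.
Qed.

Lemma crank_perm : perm_eq (map (crank W) (iota 0 m)) (iota 0 m).
Proof.
have u : uniq (map (crank W) (iota 0 m)).
  rewrite map_inj_in_uniq ?iota_uniq // => i j; rewrite !mem_iota => hi hj; exact: crank_inj.
apply: uniq_perm (iota_uniq _ _) _ => //; apply: (uniq_min_size u _ _).2.
  by move=> x /mapP[i]; rewrite !mem_iota => hi ->; apply: crank_lt_size.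
by rewrite size_map.
Qed.

Lemma invrank_lt a : a < m -> invrank W a < m.
Proof.
move=> ha; rewrite /invrank -/m -[X in _ < X](size_iota 0 m) -(size_map (crank W)) index_mem.
by rewrite (perm_mem crank_perm) mem_iota.
Qed.

Lemma invrankK a : a < m -> crank W (invrank W a) = a.
Proof.
move=> ha; have := invrank_lt ha => h.
have := nth_index 0 (_ : a \in map (crank W) (iota 0 m)).
rewrite (perm_mem crank_perm) mem_iota -/(invrank W a) => /(_ ha).
by rewrite (nth_map 0) ?size_iota // nth_iota.
Qed.

Let nxt i := i.+1 %% m.

Lemma nxt_lt i : nxt i < m.
Proof. by rewrite ltn_mod; rewrite /m; lia. Qed.

Lemma rot_cons i : i < m -> exists s,
  rot i W = nth false W i :: s /\ rot (nxt i) W = rcons s (nth false W i).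
Proof.
move=> hi; exists (drop i.+1 W ++ take i W); split.
  by rewrite /rot (drop_nth false).
rewrite /nxt; case: (ltnP i.+1 m) => h.
  by rewrite modn_small // /rot (take_nth false) // rcons_cat.
have e : i.+1 = m by lia.
rewrite e modnn rot0 drop_size cat0s -take_nth //.
by rewrite e take_size.
Qed.

(** Rotations beginning with L precede those beginning with R, so they occupy the first [l]
    ranks. *)
Lemma strand_over_lt a : a < m -> strand_over W a = (a < l).
Proof.
have cW : count (fun i => ~~ nth false W i) (iota 0 m) = l.
  by rewrite /l -[in RHS](mkseq_nth false W) /mkseq count_map.
move=> ha; rewrite /strand_over; set j := invrank W a.
have hj : j < m by exact: invrank_lt.
have E i : i < m -> exists s, rot i W = nth false W i :: s by move=> /rot_cons[s []]; exists s.
have [s sE] := E j hj.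
have aE : a = count (fun i => lexlt (rot i W) (rot j W)) (iota 0 m) by rewrite -{1}(invrankK ha).
case: (boolP (nth false W j)) => Wj /=.
  apply/esym/negbTE; rewrite -leqNgt aE -cW; apply: sub_in_count => i.
  rewrite mem_iota => hi Wi; have [s' ->] := E i hi.
  by rewrite sE Wj (negPf Wi).
(* Only rotations beginning with L lie below, and the rotation itself is not counted; hence the
   strict bound. *)
apply/esym; rewrite aE -cW.
have -> : iota 0 m = iota 0 j ++ j :: iota j.+1 (m - j.+1).
  have -> : j :: iota j.+1 (m - j.+1) = iota j (m - j) by rewrite -[m - j]prednK ?subn_gt0 //= -subnS.
  by rewrite -[in iota j _](add0n j) -iotaD subnKC // ltnW.
rewrite !count_cat /= lexlt_irr Wj add0n add1n addnS ltnS.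
apply: leq_add; apply: sub_in_count => i; rewrite mem_iota => hi;
have [|s' ->] := E i; try lia; rewrite sE (negPf Wj) /=; by case: (nth false W i).
Qed.

Lemma strand_target_lt a : a < m -> strand_target W a < m.
Proof. by move=> _; apply: crank_lt_size; apply: nxt_lt. Qed.

(** If two rotations begin with the same letter, moving it to the end preserves their order. *)
Lemma strand_target_mono x y : x < y < m -> (x < l) = (y < l) ->
  strand_target W x < strand_target W y.
Proof.
case/andP=> xy ym; have xm := ltn_trans xy ym.
rewrite -!strand_over_lt // /strand_over => /negb_inj Wxy.
rewrite /strand_target -/m -/(nxt _) -/(nxt _) crank_lt ?nxt_lt //.
have [s [sE sE']] := rot_cons (invrank_lt xm); have [s' [tE tE']] := rot_cons (invrank_lt ym).
have := crank_lt (invrank_lt xm) (invrank_lt ym); rewrite !invrankK // xy sE tE sE' tE'.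
rewrite Wxy /= eqxx /= => /esym h.
have ss : size s = size s'.
  have := congr1 size sE; have := congr1 size tE; rewrite !size_rot /=; lia.
rewrite -!cats1; apply: lexlt_cat => //.
by move: h; case: (nth _ _ _).
Qed.

Lemma strand_target_perm : perm_eq (map (strand_target W) (iota 0 m)) (iota 0 m).
Proof.
have u : uniq (map (strand_target W) (iota 0 m)).
  rewrite map_inj_in_uniq ?iota_uniq // => i j; rewrite !mem_iota => hi hj.
  move=> /(crank_inj (nxt_lt _) (nxt_lt _)); rewrite /nxt -[(invrank W i).+1]addn1 -[(invrank W j).+1]addn1.
  move=> /eqP; rewrite eqn_modDr !modn_small ?invrank_lt // => /eqP e.
  by rewrite -[i]invrankK // e invrankK.
apply: uniq_perm (iota_uniq _ _) _ => //; apply: (uniq_min_size u _ _).2.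
  by move=> x /mapP[i]; rewrite !mem_iota => hi ->; apply: strand_target_lt.
by rewrite size_map.
Qed.

(** A strand joins the ranks of consecutive rotations, which differ for length at least [2]; this
    later yields the form [R c L]. *)
Lemma strand_target_neq a : a < m -> strand_target W a <> a.
Proof.
move=> ha e; have := crank_inj (nxt_lt _) (invrank_lt ha) (_ : crank W (nxt (invrank W a)) = _).
rewrite invrankK // => /(_ e); rewrite /nxt; have := invrank_lt ha.
case: (ltnP (invrank W a).+1 m) => h _; first by rewrite modn_small //; lia.
have -> : (invrank W a).+1 = m by have := invrank_lt ha; lia.
by rewrite modnn => e0; move: h; rewrite -e0 /m; lia.
Qed.

Lemma has_letter_primitive x : has (pred1 x) W.
Proof.
apply: contraT => h; case: W_prim => _ /(_ [:: ~~ x] m W_size) [].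
have : all (pred1 (~~ x)) W.
  apply/allP => y yW; move: h; rewrite -all_predC => /allP /(_ y yW) /=.
  by case: x y {yW} => [] [].
by move=> /all_pred1P {1}->; rewrite -/m; elim: m => //= n ->.
Qed.

End Rank.

(** * The closure of a modular braid and the final count *)

Local Open Scope ring_scope.

(** The rank-one term replaces the last row by [e_k], at weight [t^k]; this relates the minor in
    [closure_alex_minor] to the normalised one. *)
Lemma lorenz_alex_last_minor (A : comNzRingType) (t : A) b k : size b = k.+1 ->
  \det (nat_mx k (alex_entry t b)) = t ^+ k * lorenz_alex t b.
Proof.
move=> sb; pose u (i : nat) : A := (i == k)%:R.
pose w (j : nat) : A := (j == k)%:R - alex_entry t b k j.
have := @lorenz_bordered _ t b u w; rewrite sb => /(_ isT).
rewrite (sum_delta (fun i => t ^+ i)) //.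
have -> : \sum_(j < k.+1) w j = 1.
  rewrite sumrB; under eq_bigr do rewrite -[_%:R]mul1r.
  rewrite (sum_delta (fun => 1)) // /alex_entry sumrB.
  under eq_bigr do rewrite eq_sym -[_%:R]mul1r.
  rewrite (sum_delta (fun => 1)) // -sb lorenz_row_sum ?sb //.
  by rewrite subrr subr0.
rewrite mulr1 => <-; set F := fun i j => _.
have F1 i j : (i < k)%N -> F i j = alex_entry t b i j.
  by move=> h; rewrite /F /u (ltn_eqF h) mul0r addr0.
have F2 j : F k j = (j == k)%:R by rewrite /F /u eqxx mul1r addrC subrK.
rewrite -(addn1 k).
have -> : nat_mx (k + 1) F = block_mx (nat_mx k (alex_entry t b)) (\col_i alex_entry t b i k) 0 1%:M.
  apply/matrixP=> i j; rewrite !mxE.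
  case: splitP => i' ei; rewrite !mxE; case: splitP => j' ej; rewrite ei ej !mxE ?ord1 ?addn0 ?F2 ?F1 //.
    by rewrite ltn_eqF.
  by rewrite eqxx.
by rewrite det_ublock det1 mulr1.
Qed.

Lemma modular_alex_minor (W : seq bool) : primitive W -> (2 <= size W)%N ->
  exists c, closure_alex_minor (size W) (modular_braid_word W) =
            tofrac ('X^((size c).+1) * lorenz_poly c).
Proof.
move=> Wp Ws; pose m := size W; pose l := count negb W.
have lm : (0 < l < m)%N.
  have hF := has_letter_primitive Wp Ws false; have hT := has_letter_primitive Wp Ws true.
  have l0 : (0 < l)%N by rewrite -has_count; move: hF; apply: sub_has => -[].
  have r0 : (0 < count id W)%N by rewrite -has_count; move: hT; apply: sub_has => -[].
  by rewrite l0 /m -(count_LR W) -/l -[X in (X < _)%N]addn0 ltn_add2l.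
have mono x y : (x < y < m)%N -> (x < l)%N = (y < l)%N ->
  (strand_target W x < strand_target W y)%N by apply: strand_target_mono.
have monoL x y : (x < y < l)%N -> (strand_target W x < strand_target W y)%N.
  by move=> h; apply: mono; lia.
have monoR x y : (l <= x)%N -> (x < y < m)%N -> (strand_target W x < strand_target W y)%N.
  by move=> h h'; apply: mono; lia.
have [] := lorenz_burau lm monoL monoR (strand_target_perm Wp Ws) (@strand_over_lt W Wp Ws).
set b := map _ _ => sb cb tb Eb.
have tlt x : (x < m)%N -> (strand_target W x < m)%N by apply: strand_target_lt.
have tne x : (x < m)%N -> strand_target W x <> x by apply: strand_target_neq.
(* By monotonicity an L-strand ending at [0] would be strand [0], a fixed point; symmetrically for
   an R-strand ending last. *)
have b0 : nth false b 0.
  have [|x xm [tx ->]] := tb 0%N; first by lia.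
  rewrite leqNgt; apply/negP => xl; have := tne x xm; rewrite tx.
  by case: x xm tx xl => // x xm tx xl; have := monoL 0%N x.+1; rewrite tx xl => /(_ isT).
have bm : nth false b m.-1 = false.
  have [|x xm [tx ->]] := tb m.-1; first by lia.
  apply/negbTE; rewrite -ltnNge ltnNge; apply/negP => lx; have := tne x xm; rewrite tx => ne.
  have := monoR x m.-1 lx; have := tlt m.-1; rewrite tx; lia.
have [c bE] : exists c, b = close_word c.
  case: (b) sb b0 bm => [|x b'] /=; first by rewrite -/m => <-.
  move=> sb' -> ; case/lastP: b' sb' => [|c y].
    by move=> /= e; move: Ws; rewrite -e.
  rewrite size_rcons /m => <- /=; rewrite nth_rcons ltnn eqxx => ->.
  by exists c.
exists c; have sc : size W = (size c).+2 by rewrite -/m -sb bE size_close_word.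
have mc : (size c).+1 = m.-1 by rewrite /m sc.
rewrite mc tofracM tofracXn -/tt /lorenz_poly lorenz_alex_map -/tt -bE.
rewrite -lorenz_alex_last_minor; last by rewrite sb -mc; exact: sc.
rewrite /closure_alex_minor -/m.
congr (\det _); apply/matrixP=> i j; rewrite !mxE /=.
by rewrite /modular_braid_word Eb.
Qed.

Local Open Scope nat_scope.

Theorem theorem7p1 (n : nat) :
  0 < n -> ~~ odd n ->
  exists S : seq {poly int},
    size S <= partition_number n /\
    (forall (W : seq bool) (p : {poly int}),
       primitive W -> 2 <= size W ->
       is_alexander_of_modular W p -> size p = n.+1 -> p \in S).
Proof.
move=> _ _.
pose wf (f : {ffun 'I_n -> 'I_n.+1}) := partition_word [seq (f i : nat) | i <- enum 'I_n].
(* One candidate per multiplicity function; the factor, its value at [1], fixes the sign. *)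
exists [seq ((lorenz_poly (wf f)).[1] *: lorenz_poly (wf f))%R |
  f : {ffun 'I_n -> 'I_n.+1} in [set f : {ffun 'I_n -> 'I_n.+1} | \sum_(i < n) (i.+1 * f i) == n]].
split; first by rewrite size_map -cardE.
move=> W p pW sW [p0 [p1 [e [k Ep]]]] sp.
have [c Ec] := modular_alex_minor pW sW; rewrite Ec in Ep.
have pE := eq_up_to_unit p0 p1 (coef0_lorenz_alex c) Ep.
have sPc : size (lorenz_poly c) = n.+1.
  rewrite -sp pE size_scale //; apply/eqP => h.
  by move: p1; rewrite pE h scale0r horner0.
have [k0 [ks0 cE]] := partition_word_surj c.
(* Padding with zeros, i.e. appending trailing [R]'s, makes [take n ks] have size [n]. *)
pose ks := ks0 ++ nseq n 0.
have sks : (n <= size ks) by rewrite size_cat size_nseq leq_addl.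
have Pks : lorenz_poly (partition_word ks) = lorenz_poly c.
  by rewrite cE lorenz_poly_stripL partition_word_rcons0 lorenz_poly_stripR.
have sumks : (\sum_(i < size ks) i.+1 * nth 0 ks i = n).
  by rewrite -inversions_partition_word; apply/succn_inj; rewrite -size_lorenz_alex -sPc -Pks.
have le i : (i < size ks) -> (i.+1 * nth 0 ks i <= n).
  by move=> hi; rewrite -[X in (_ <= X)]sumks (bigD1 (Ordinal hi)) //= leq_addr.
(* A part larger than [n] would exceed the sum, so the multiplicities from index [n] on vanish. *)
have dropE : drop n ks = nseq (size (drop n ks)) 0.
  apply/all_pred1P/(all_nthP 0) => i; rewrite size_drop nth_drop => hi /=.
  have := le (n + i); rewrite -ltn_subRL => /(_ hi).
  by case: (nth _ _ _) => // x; lia.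
have Ptake : lorenz_poly (partition_word (take n ks)) = lorenz_poly c.
  by rewrite -Pks -[in RHS](cat_take_drop n ks) dropE partition_word_rcons0 lorenz_poly_stripR.
have st : size (take n ks) = n by rewrite size_takel.
pose f : {ffun 'I_n -> 'I_n.+1} := [ffun i : 'I_n => inord (nth 0 ks i)].
have fE (i : 'I_n) : f i = nth 0 (take n ks) i :> nat.
  rewrite ffunE nth_take // inordK // ltnS.
  have hi : (i < size ks) by apply: leq_trans sks.
  by apply: leq_trans (le i hi); rewrite leq_pmull.
have wfE : wf f = partition_word (take n ks).
  congr partition_word; apply: (@eq_from_nth _ 0); first by rewrite size_map size_enum_ord st.
  move=> i; rewrite size_map size_enum_ord => hi.
  by rewrite (nth_map (Ordinal hi)) ?size_enum_ord // fE nth_enum_ord.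
apply/imageP; exists f; last by rewrite wfE Ptake.
rewrite inE; apply/eqP.
have : inversions (partition_word (take n ks)) = n.
  by apply/succn_inj; rewrite -size_lorenz_alex -sPc -Ptake.
rewrite inversions_partition_word st => sumn.
rewrite -[RHS]sumn; by apply: eq_bigr => i _; rewrite fE.
Qed.
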